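(* Let $d\ge1$ and $\nu>0$. Assume $u_0:\mathbb{R}^d\to\mathbb{R}^d$ and $g:\mathbb{R}_+\times\mathbb{R}^d\to\mathbb{R}^d$ are smooth, that $\|\nabla^\kappa u_0\|_\infty<\infty$ for all $\kappa=0,1,2,\dots$, and that for all $\mu,\kappa=0,1,2,\dots$ and every $T>0$ there is a finite constant $C(\mu,\kappa,T)$ with $\|\partial_t^\mu\nabla^\kappa g_t\|_\infty<C(\mu,\kappa,T)$ for every $t\le T$. Then the viscous Burgers equation $$(\partial_t-\nu\Delta+u\cdot\nabla)u=g\ \text{ on }\mathbb{R}_+\times\mathbb{R}^d,\qquad u|_{t=0}=u_0,$$ has a unique smooth solution $u$ such that, for all $\mu,\kappa$ and $T>0$, there is a finite constant $C'(\mu,\kappa,T)$ with $\|\partial_t^\mu\nabla^\kappa u_t\|_\infty<C'(\mu,\kappa,T)$ for every $t\le T$. In particular, if $g=0$, the constants $C'(\mu,\kappa,T)=C'(\mu,\kappa)$ can be taken independent of $T$.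
   Context: $f_t:=f(t,\cdot)$; $\nabla,\Delta$ act on the space variables; $u\cdot\nabla u=\sum_{i=1}^du_i\partial_{x_i}u$; $\|h\|_\infty=\sup_{x\in\mathbb{R}^d}|h(x)|$. *)

(* Defs.v *)
From HB Require Import structures.
From mathcomp Require Import all_boot all_order all_algebra.
From mathcomp Require Import all_classical all_reals all_analysis.

Set Implicit Arguments.
Unset Strict Implicit.
Unset Printing Implicit Defensive.
Import Order.TTheory GRing.Theory Num.Theory.
Import numFieldNormedType.Exports.
Local Open Scope classical_set_scope.
Local Open Scope ring_scope.

Section TimeDerivative.
Context {R : realType} {V : normedModType R}.

(* The derivative at t of a function on the closed half-line [0, +oo[: the
   increment h is constrained by 0 <= h + t, so that this is the ordinary
   derivative when 0 < t and the right derivative when t = 0. The values of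
   phi at negative times play no role. *)
Definition time_quotient (phi : R -> V) (t : R) : set_system V :=
  h^-1 *: (phi (h + t) - phi t) @[h --> within [set h | 0 <= h + t] 0^'].

Definition time_derivable (phi : R -> V) (t : R) : Prop :=
  cvg (time_quotient phi t).

Definition time_derive (phi : R -> V) (t : R) : V :=
  lim (time_quotient phi t).

Lemma time_quotient_gt0 (phi : R -> V) (t : R) : 0 < t ->
  time_quotient phi t = (h^-1 *: ((phi \o shift t) (h *: 1) - phi t) @[h --> 0^']).
Proof.
move=> t0; rewrite /time_quotient.
have -> : within [set h | 0 <= h + t] 0^' = 0^' :> set_system R.
  apply/seteqP; split => A; rewrite /within /= => HA; last first.
    by apply: filterS HA => h Ah _.
  have Ht : nbhs 0^' [set h | 0 <= h + t].
    apply: nbhs_dnbhs; exists t => //= h /=; rewrite sub0r normrN => ht.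
    by rewrite -lerBlDr sub0r; apply: ltW; move: ht; rewrite ltr_norml => /andP[].
  by apply: filterS2 HA Ht => h; apply.
rewrite /= (_ : (fun h => _) = (fun h : R => h^-1 *: (phi (h *: 1 + t) - phi t)))//.
by apply/funext => h; rewrite [_%:A]mulr1.
Qed.

Lemma time_derivable_gt0 (phi : R -> V) (t : R) : 0 < t ->
  time_derivable phi t = derivable phi t 1.
Proof. by move=> t0; rewrite /time_derivable time_quotient_gt0. Qed.

Lemma time_derive_gt0 (phi : R -> V) (t : R) : 0 < t ->
  time_derive phi t = 'D_1 phi t.
Proof. by move=> t0; rewrite /time_derive time_quotient_gt0. Qed.

End TimeDerivative.

Section Fields.
Context {R : realType} {d : nat}.
Local Notation E := 'rV[R]_d.

Definition unit_vec (i : 'I_d) : E := delta_mx 0 i.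

(* partial_derive [:: i1; ...; ik] h is d_i1 (... (d_ik h)) *)
Definition partial_derive (s : seq 'I_d) (h : E -> E) : E -> E :=
  foldr (fun i k x => 'D_(unit_vec i) k x) h s.

Definition smooth (h : E -> E) : Prop :=
  forall s : seq 'I_d,
    (forall (i : 'I_d) (x : E), derivable (partial_derive s h) x (unit_vec i)) /\
    continuous (partial_derive s h).

(* The coordinates of R_+ x R^d: None is time, Some i the i-th space variable. *)
Definition coord_derivable (a : option 'I_d) (f : R -> E -> E) (t : R) (x : E) :
    Prop :=
  if a is Some i then derivable (f t) x (unit_vec i)
  else time_derivable (f^~ x) t.

Definition coord_derive (a : option 'I_d) (f : R -> E -> E) : R -> E -> E :=
  fun t x => if a is Some i then 'D_(unit_vec i) (f t) x
             else time_derive (f^~ x) t.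

(* C^oo on the closed set R_+ x R^d: all iterated partial derivatives, taken in
   any order (one-sided in time at t = 0), exist and are jointly continuous. *)
Definition smooth_on_halfspace (f : R -> E -> E) : Prop :=
  forall w : seq (option 'I_d),
    (forall (a : option 'I_d) (t : R) (x : E), 0 <= t ->
       coord_derivable a (foldr coord_derive f w) t x) /\
    {within [set z : R * E | 0 <= z.1],
       continuous (fun z => foldr coord_derive f w z.1 z.2)}.

(* The tensors (of order k, with values in R^d) in which nabla^k h lives. *)
Definition tensor (k : nat) := {ffun k.-tuple 'I_d -> E}.

Definition nabla (k : nat) (h : E -> E) (x : E) : tensor k :=
  [ffun s : k.-tuple 'I_d => partial_derive s h x].

Definition dt_nabla (mu k : nat) (f : R -> E -> E) (t : R) (x : E) : tensor k :=
  [ffun s => iter mu time_derive (fun r => nabla k (f r) x s) t].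

(* The norm `|_| of the library on 'rV[R]_d is the max norm; this is the
   Euclidean one. *)
Definition tensor_norm (k : nat) (A : tensor k) : R :=
  Num.sqrt (\sum_(s : k.-tuple 'I_d) \sum_(j < d) (A s) 0 j ^+ 2).

Definition sup_norm (k : nat) (F : E -> tensor k) : \bar R :=
  ereal_sup [set (tensor_norm (F x))%:E | x in [set: E]].

Definition bounded_derivatives (f : R -> E -> E) : Prop :=
  forall (mu k : nat) (T : R), 0 < T ->
    exists C : R, forall t : R, 0 <= t -> t <= T ->
      (sup_norm (dt_nabla mu k f t) < C%:E)%E.

Definition laplacian (h : E -> E) (x : E) : E :=
  \sum_(i < d) 'D_(unit_vec i) (fun y => 'D_(unit_vec i) h y) x.

Definition advection (b h : E -> E) (x : E) : E :=
  \sum_(i < d) (b x) 0 i *: 'D_(unit_vec i) h x.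

Definition burgers_solution (nu : R) (u0 : E -> E) (g u : R -> E -> E) : Prop :=
  [/\ smooth_on_halfspace u,
      forall (t : R) (x : E), 0 <= t ->
        time_derive (u^~ x) t - nu *: laplacian (u t) x
          + advection (u t) (u t) x = g t x
    & forall x : E, u 0 x = u0 x].

End Fields.

(* Main.v *)
Require Import Defs.
From mathcomp Require Import all_boot all_order all_algebra.
From mathcomp Require Import all_classical all_reals all_analysis.
From mathcomp Require Import zify ring lra.

Import Order.TTheory GRing.Theory Num.Theory.
Import numFieldNormedType.Exports.
Local Open Scope classical_set_scope.
Local Open Scope ring_scope.

Set Implicit Arguments.
Unset Strict Implicit.
Unset Printing Implicit Defensive.

(* The solution is a limit of the explicit finite-difference scheme
     u_{n+1} = S u_n - tau sum_i (u_n)_i D_i u_n + tau g(n tau),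
   where S averages over the neighbours at distance eps (a discrete heat step),
   D_i is a central difference and tau = eps^2 / (4 d nu). It acts on functions
   of the continuous variable x, so it commutes with d/dx_i and the spatial
   derivatives of u_n obey schemes of the same form. For small eps one step is a
   convex combination plus the forcing, which gives the maximum principle. A
   two-point version of that principle (lemma barrier) bounds D_i u_n, and then
   inductively all D_i d^s u_n, in terms of the data alone: the transport term
   grows linearly in the slope L while the barrier yields L^2. Hence, when g = 0,
   the bounds do not depend on the time horizon. With all spatial derivatives
   bounded uniformly in eps, the limit is taken along an ultrafilter on the
   meshes eps = 1/(m+1): Taylor estimates in x and in t pass to the limit, so the
   limit is differentiable and solves the equation. Conversely, consistency and
   stability of the scheme show that every solution with bounded derivatives is
   the limit of the scheme, whence uniqueness. *)

(** * Derivatives and finite differences *)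

(** Differentiating the equation in space produces a term quadratic in the gradient, so the
    one-point maximum principle yields only a Riccati inequality, which allows blow-up in finite
    time. In the two-point comparison the slope enters the forcing linearly, and this breaks the
    circle. That comparison, however, controls central differences and not derivatives; passing from
    one to the other costs a multiple of eps whose factor bounds derivatives one order higher still.
    Hence two rounds of estimates: a Gronwall bound ([crude_bound]), which depends on T, and a
    second bound ([uniform_bound]), into which the first enters only through a product [C2 * eps]
    made at most 1. The horizon then decides how small eps must be, but leaves the bound alone.
    Higher time derivatives are never estimated on the scheme. On the limit, each time derivative is
    replaced through the equation, so every iterated derivative becomes a polynomial in spatial
    derivatives of the solution and derivatives of g. Smoothness in all orders of differentiation
    and all the bounds follow from this closure. *)

Section RealValuedDerivatives.
Context {R : realType} {V : normedModType R}.
Implicit Types (f g : V -> R) (x v : V).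

Lemma is_derive_val f x v (a b : R) :
  is_derive x v f a -> a = b -> is_derive x v f b.
Proof. by move=> ? <-. Qed.

Lemma is_deriveD_fun f g x v (df dg : R) :
  is_derive x v f df -> is_derive x v g dg ->
  is_derive x v (fun y => f y + g y) (df + dg).
Proof. by move=> ? ?; exact: is_deriveD. Qed.

Lemma is_deriveB_fun f g x v (df dg : R) :
  is_derive x v f df -> is_derive x v g dg ->
  is_derive x v (fun y => f y - g y) (df - dg).
Proof. by move=> ? ?; exact: is_deriveB. Qed.

Lemma is_deriveM_fun f g x v (df dg : R) :
  is_derive x v f df -> is_derive x v g dg ->
  is_derive x v (fun y => f y * g y) (df * g x + f x * dg).
Proof.
move=> hf hg; apply: is_derive_val (is_deriveM hf hg) _.
by rewrite /GRing.scale/= addrC [g x * df]mulrC.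
Qed.

Lemma is_deriveMl_fun f x v (c df : R) :
  is_derive x v f df -> is_derive x v (fun y => c * f y) (c * df).
Proof. by move=> ?; exact: (@is_deriveZ _ _ _ f c x v df). Qed.

Lemma is_derive_cst_fun x v (c : R) : is_derive x v (fun=> c) 0.
Proof. exact: is_derive_cst. Qed.

Lemma is_derive_sum_fun (I : Type) (s : seq I) (F : I -> V -> R) (dF : I -> R) x v :
  (forall i, is_derive x v (F i) (dF i)) ->
  is_derive x v (fun y => \sum_(i <- s) F i y) (\sum_(i <- s) dF i).
Proof.
move=> dFi; elim: s => [|i s ih].
  rewrite big_nil (_ : (fun y => _) = fun=> 0); first exact: is_derive_cst_fun.
  by apply/funext => y; rewrite big_nil.
rewrite big_cons (_ : (fun y => _) = fun y => F i y + \sum_(i <- s) F i y).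
  exact: is_deriveD_fun.
by apply/funext => y; rewrite big_cons.
Qed.

End RealValuedDerivatives.

Section Taylor.
Context {R : realType}.

(** The derivative is asked for on the open interval only, so that functions of time starting at 0,
    where the derivative is one-sided, are covered. *)
Lemma mvt_le (phi phi' : R -> R) (a b C : R) : a <= b ->
  (forall r : R, a < r < b -> is_derive r 1 phi (phi' r)) ->
  {within `[a, b], continuous phi} ->
  (forall r, a <= r <= b -> `|phi' r| <= C) ->
  `|phi b - phi a| <= C * (b - a).
Proof.
move=> ab dphi cphi bphi.
have dphi' r : r \in `]a, b[%R -> is_derive r 1 phi (phi' r).
  by rewrite in_itv/=; exact: dphi.
have [c cab ->] := MVT_segment ab dphi' cphi.
rewrite normrM (ger0_norm (_ : 0 <= b - a)) ?subr_ge0//.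
by rewrite ler_wpM2r ?subr_ge0//; apply: bphi; move: cab; rewrite in_itv.
Qed.

Lemma mvt_le_origin (phi phi' : R -> R) (C r : R) :
  (forall p : R, is_derive p 1 phi (phi' p)) ->
  (forall p, `|p| <= `|r| -> `|phi' p| <= C) ->
  `|phi r - phi 0| <= C * `|r|.
Proof.
move=> dphi bphi.
have cphi (a b : R) : {within `[a, b], continuous phi}.
  apply: derivable_within_continuous => x _.
  exact: (@ex_derive _ _ _ _ _ _ _ (dphi x)).
have [r0|r0] := leP 0 r.
  rewrite (_ : `|r| = r - 0); last by rewrite subr0 ger0_norm.
  apply: (mvt_le (phi' := phi')) => // p /andP[p0 pr].
  by apply: bphi; rewrite !ger0_norm.
rewrite distrC (_ : `|r| = 0 - r); last by rewrite sub0r ltr0_norm.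
apply: (mvt_le (phi' := phi')) => //; first exact: ltW.
by move=> p /andP[p0 pr]; apply: bphi; rewrite !ler0_norm ?lerN2// ltW.
Qed.

Context {d : nat}.
Local Notation E := 'rV[R]_d.
Local Notation e := (@unit_vec R d).
Implicit Types (i : 'I_d) (x : E).

Definition has_partial (i : 'I_d) (f f' : E -> R) : Prop :=
  forall x : E, is_derive x (e i) f (f' x).

Lemma has_partial_line i (f f' : E -> R) x (r : R) : has_partial i f f' ->
  is_derive r 1 (fun p => f (x + p *: e i)) (f' (x + r *: e i)).
Proof.
move=> /(_ (x + r *: e i)) [df vf].
have H : (fun h : R => h^-1 *: (f (h *: e i + (x + r *: e i)) - f (x + r *: e i)))
   = (fun h : R => h^-1 *: (f (x + (h *: 1 + r) *: e i) - f (x + r *: e i))).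
  by apply/funext => h; rewrite [h *: 1]mulr1 scalerDl addrCA.
split; first by rewrite /derivable /= -H.
by rewrite -vf /derive /= -H.
Qed.

Lemma taylor1 i (f f1 : E -> R) (C : R) x r : has_partial i f f1 ->
  (forall y, `|f1 y| <= C) -> `|f (x + r *: e i) - f x| <= C * `|r|.
Proof.
move=> df bf.
have := @mvt_le_origin (fun p => f (x + p *: e i)) (fun p => f1 (x + p *: e i)) C r.
by rewrite scale0r addr0; apply => // p; exact: has_partial_line.
Qed.

(** As a function of [r] the remainder vanishes at 0, and its derivative is the remainder of
    [taylor1] for [f1]; the mean value inequality concludes, at the price of the usual factor 1/2.
    [taylor3] iterates this once more. *)
Lemma taylor2 i (f f1 f2 : E -> R) (C : R) x r : has_partial i f f1 ->
  has_partial i f1 f2 -> (forall y, `|f2 y| <= C) ->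
  `|f (x + r *: e i) - f x - r * f1 x| <= C * r ^+ 2.
Proof.
move=> df df1 bf.
have := @mvt_le_origin (fun p => f (x + p *: e i) - p * f1 x)
  (fun p => f1 (x + p *: e i) - f1 x) (C * `|r|) r.
rewrite scale0r addr0 mul0r subr0 addrAC -mulrA -normrM -expr2.
rewrite (ger0_norm (sqr_ge0 r)); apply => [p|p pr].
  have did : is_derive p 1 (fun q : R => q) 1 := is_derive_id p 1.
  apply: is_derive_val (is_deriveB_fun (has_partial_line x p df)
    (is_deriveM_fun did (is_derive_cst_fun _ _ (f1 x)))) _.
  by rewrite mul1r mulr0 addr0.
apply: le_trans (taylor1 x p df1 bf) _; apply: ler_wpM2l => //.
by apply: le_trans (bf x).
Qed.

Lemma taylor3 i (f f1 f2 f3 : E -> R) (C : R) x r : has_partial i f f1 ->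
  has_partial i f1 f2 -> has_partial i f2 f3 -> (forall y, `|f3 y| <= C) ->
  `|f (x + r *: e i) - f x - r * f1 x - r ^+ 2 / 2 * f2 x| <= C * `|r| ^+ 3.
Proof.
move=> df df1 df2 bf.
have := @mvt_le_origin (fun p => f (x + p *: e i) - p * f1 x - p ^+ 2 / 2 * f2 x)
  (fun p => f1 (x + p *: e i) - f1 x - p * f2 x) (C * `|r| ^+ 2) r.
rewrite scale0r addr0 mul0r subr0 expr0n/= !mul0r subr0.
rewrite (_ : C * `|r| ^+ 2 * `|r| = C * `|r| ^+ 3); last by ring.
rewrite (_ : _ - f x = f (x + r *: e i) - f x - r * f1 x - r ^+ 2 / 2 * f2 x);
  last by ring.
apply => [p|p pr].
  have did : is_derive p 1 (fun q : R => q) 1 := is_derive_id p 1.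
  apply: is_derive_val (is_deriveB_fun (is_deriveB_fun (has_partial_line x p df)
     (is_deriveM_fun did (is_derive_cst_fun _ _ (f1 x))))
     (is_deriveM_fun (is_deriveM_fun (is_deriveM_fun did did)
       (is_derive_cst_fun _ _ 2^-1)) (is_derive_cst_fun _ _ (f2 x)))) _.
  by field.
apply: le_trans (taylor2 x p df1 df2 bf) _; apply: ler_wpM2l => //.
  by apply: le_trans (bf x).
by rewrite -[p ^+ 2]ger0_norm ?sqr_ge0// normrX lerXn2r ?nnegrE.
Qed.

Definition cdiff (eps : R) (i : 'I_d) (f : E -> R) (x : E) : R :=
  (f (x + eps *: e i) - f (x - eps *: e i)) / (2 * eps).

Definition sdiff (eps : R) (i : 'I_d) (f : E -> R) (x : E) : R :=
  (f (x + eps *: e i) + f (x - eps *: e i) - 2 * f x) / eps ^+ 2.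

Section Consistency.
Context (eps : R) (i : 'I_d) (C : R).

Lemma cdiff_le (f f1 : E -> R) x : 0 < eps -> has_partial i f f1 ->
  (forall y, `|f1 y| <= C) -> `|cdiff eps i f x| <= C.
Proof.
move=> eps0 df bf; have e2 : 0 <= eps + eps by lra.
have := taylor1 (x - eps *: e i) (eps + eps) df bf.
rewrite scalerDl addrA subrK (ger0_norm e2) => H; rewrite /cdiff normrM (ger0_norm (_ : 0 <= (2 * eps)^-1)); last first.
  by rewrite invr_ge0; lra.
by rewrite ler_pdivrMr; lra.
Qed.

Lemma cdiff_consistent (f f1 f2 : E -> R) x : 0 < eps -> has_partial i f f1 ->
  has_partial i f1 f2 -> (forall y, `|f2 y| <= C) ->
  `|cdiff eps i f x - f1 x| <= C * eps.
Proof.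
move=> eps0 df df1 bf.
have Hp := taylor2 x eps df df1 bf; have := taylor2 x (- eps) df df1 bf.
rewrite scaleNr sqrrN => Hm.
rewrite /cdiff (_ : _ - f1 x = ((f (x + eps *: e i) - f x - eps * f1 x)
   - (f (x - eps *: e i) - f x - - eps * f1 x)) / (2 * eps)); last by field; lra.
rewrite normrM (ger0_norm (_ : 0 <= (2 * eps)^-1)); last first.
  by rewrite invr_ge0; lra.
rewrite ler_pdivrMr; last by lra.
by apply: le_trans (ler_normB _ _) _; lra.
Qed.

(** The first-order terms of the two expansions cancel and the second-order terms add up to [f2]. An
    error of order eps suffices, as it is later weighted by [tau] and summed over a bounded time. *)
Lemma sdiff_consistent (f f1 f2 f3 : E -> R) x : 0 < eps -> has_partial i f f1 ->
  has_partial i f1 f2 -> has_partial i f2 f3 -> (forall y, `|f3 y| <= C) ->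
  `|sdiff eps i f x - f2 x| <= 2 * C * eps.
Proof.
move=> eps0 df df1 df2 bf.
have Hp := taylor3 x eps df df1 df2 bf.
have := taylor3 x (- eps) df df1 df2 bf.
rewrite scaleNr sqrrN normrN => Hm; move: Hp Hm; rewrite (gtr0_norm eps0) => Hp Hm.
rewrite /sdiff (_ : _ - f2 x =
   ((f (x + eps *: e i) - f x - eps * f1 x - eps ^+ 2 / 2 * f2 x)
   + (f (x - eps *: e i) - f x - - eps * f1 x - eps ^+ 2 / 2 * f2 x))
   / eps ^+ 2); last by field; lra.
rewrite normrM (ger0_norm (_ : 0 <= (eps ^+ 2)^-1)); last first.
  by rewrite invr_ge0 sqr_ge0.
rewrite ler_pdivrMr ?exprn_gt0//.
apply: le_trans (ler_normD _ _) _; apply: le_trans (lerD Hp Hm) _.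
by rewrite le_eqVlt; apply/orP; left; apply/eqP; ring.
Qed.

End Consistency.

Lemma sumr_coord x : x = \sum_(i < d) x 0 i *: e i.
Proof. exact: row_sum_delta. Qed.

(** One coordinate is moved at a time, and the increments telescope. *)
Lemma lipschitz_coordinates (f : E -> R) (C : R) :
  (forall i x r, `|f (x + r *: e i) - f x| <= C * `|r|) ->
  forall x y, `|f y - f x| <= C * \sum_(i < d) `|y 0 i - x 0 i|.
Proof.
move=> lip x y.
have H (s : seq 'I_d) (z : E) : `|f (z + \sum_(i <- s) (y - x) 0 i *: e i) - f z|
    <= C * \sum_(i <- s) `|y 0 i - x 0 i|.
  elim: s z => [|i s ih] z; first by rewrite !big_nil addr0 subrr normr0 mulr0.
  rewrite !big_cons addrA mulrDr.
  set z' := z + _; set z'' := z' + _.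
  rewrite (_ : f z'' - f z = (f z' - f z) + (f z'' - f z')); last by ring.
  apply: le_trans (ler_normD _ _) _; apply: lerD; last exact: ih.
  by apply: le_trans (lip _ _ _) _; rewrite !mxE.
have := H (index_enum 'I_d) x.
by rewrite -sumr_coord (addrC x) subrK.
Qed.

End Taylor.

(** * The scheme *)

(** The time step for which [avg eps f - f] is exactly [tau] times [nu] times the discrete Laplacian
    of [f]; [avg] gives weight 1/2 to the centre. *)
Definition tau {R : realType} (d : nat) (nu eps : R) : R :=
  eps ^+ 2 / (4 * d%:R * nu).

Section Scheme.
Context {R : realType} {d : nat}.
Local Notation E := 'rV[R]_d.
Local Notation e := (@unit_vec R d).
Implicit Types (i j : 'I_d) (s : seq 'I_d) (x y : E).

Lemma norm_sum_le (I : eqType) (r : seq I) (F : I -> R) (c : R) :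
  (forall k, k \in r -> `|F k| <= c) -> `|\sum_(k <- r) F k| <= (size r)%:R * c.
Proof.
elim: r => [|i r ih] H; first by rewrite big_nil normr0 mul0r.
rewrite big_cons -[size _]/(size r).+1 -natr1 mulrDl mul1r addrC.
apply: le_trans (ler_normD _ _) _; apply: lerD.
  by apply: ih => k ks; apply: H; rewrite inE ks orbT.
by apply: H; rewrite inE eqxx.
Qed.

Lemma norm_sum_ord_le n (F : 'I_n -> R) (c : R) :
  (forall k, `|F k| <= c) -> `|\sum_(k < n) F k| <= n%:R * c.
Proof.
move=> H; have := @norm_sum_le _ (index_enum 'I_n) F c (fun k _ => H k).
by rewrite (_ : size _ = n) // /index_enum -enumT size_enum_ord.
Qed.

(* The splittings (a, b) of the word s with a nonempty: these are the terms of
   the Leibniz formula for d_s (f g) other than f (d_s g). *)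
Fixpoint proper_splits s : seq (seq 'I_d * seq 'I_d) :=
  if s is i :: s' then
    [seq (i :: p.1, p.2) | p <- ([::], s') :: proper_splits s'] ++
    [seq (p.1, i :: p.2) | p <- proper_splits s']
  else [::].

Lemma proper_splitsP s p : p \in proper_splits s ->
  [/\ (0 < size p.1)%N, (size p.1 + size p.2 = size s)%N
    & p.2 = [::] -> p.1 = s].
Proof.
elim: s p => [//|i s ih] p; rewrite [proper_splits _]/= -cat_cons mem_cat.
case/orP => [|/mapP[q /ih[q1 q2 _] ->]]; last by split=> //=; rewrite addnS q2.
rewrite inE => /orP[/eqP -> //|]; first by split => //= ->.
move/mapP => [q /ih[q1 q2 q3] ->] /=; split => //; first by rewrite addSn q2.
by move=> /q3 ->.
Qed.

Lemma size_proper_splits s : (size (proper_splits s) <= 2 ^ size s)%N.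
Proof.
(* The exact number is 2^|s| - 1, one for each nonempty choice of letters going to the first factor;
   the strict form is the one that passes through the induction. *)
suff: (size (proper_splits s) < 2 ^ size s)%N by move/ltnW.
elim: s => [//|i s ih]; rewrite /= size_cat !size_map expnS.
move: ih; lia.
Qed.

Definition avg (eps : R) (f : E -> R) (x : E) : R :=
  (\sum_(i < d) (2 * f x + f (x + eps *: e i) + f (x - eps *: e i))) / (4 * d%:R).

Context (nu : R).

(** The Leibniz expansion of the s-th derivative of sum_i u_i D_i u_j. The term without derivative
    on [u i] stands apart: it alone contains a difference of the top-order derivative [u j s]. *)
Definition transport (eps : R) (u : 'I_d -> seq 'I_d -> E -> R) j s x : R :=
  \sum_(i < d) (u i [::] x * cdiff eps i (u j s) x
    + \sum_(p <- proper_splits s) u i p.1 x * cdiff eps i (u j p.2) x).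

Definition step (eps : R) (u g : 'I_d -> seq 'I_d -> E -> R) j s x : R :=
  avg eps (u j s) x - tau d nu eps * transport eps u j s x + tau d nu eps * g j s x.

(* u j s stands for the s-th partial derivative of the j-th component. *)
Fixpoint scheme (eps : R) (u0 : 'I_d -> seq 'I_d -> E -> R)
    (g : R -> 'I_d -> seq 'I_d -> E -> R) (n : nat) : 'I_d -> seq 'I_d -> E -> R :=
  if n is m.+1 then step eps (scheme eps u0 g m) (g (m%:R * tau d nu eps)) else u0.

Definition is_jet (f : seq 'I_d -> E -> R) : Prop :=
  forall s i, has_partial i (f s) (f (i :: s)).

Lemma has_partial_shift i (f f' : E -> R) (c : E) :
  has_partial i f f' -> has_partial i (fun x => f (x + c)) (fun x => f' (x + c)).
Proof.
move=> H x; have [df vf] := H (x + c).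
have E1 : (fun h : R => h^-1 *: (f (h *: e i + (x + c)) - f (x + c)))
   = (fun h : R => h^-1 *: (f (h *: e i + x + c) - f (x + c))).
  by apply/funext => h; rewrite addrA.
split; first by rewrite /derivable /= -E1.
by rewrite -vf /derive /= -E1.
Qed.

Lemma has_partial_cdiff eps k i (f f' : E -> R) : has_partial i f f' ->
  has_partial i (cdiff eps k f) (cdiff eps k f').
Proof.
move=> H x; rewrite /cdiff.
apply: is_derive_val (is_deriveM_fun (is_deriveB_fun (has_partial_shift (eps *: e k) H x)
  (has_partial_shift (- (eps *: e k)) H x)) (is_derive_cst_fun _ _ _)) _.
by rewrite mulr0 addr0.
Qed.

Lemma has_partial_avg eps i (f f' : E -> R) : has_partial i f f' ->
  has_partial i (avg eps f) (avg eps f').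
Proof.
move=> H x; rewrite /avg.
apply: is_derive_val (is_deriveM_fun (is_derive_sum_fun _ (fun k : 'I_d =>
  is_deriveD_fun (is_deriveD_fun (is_deriveMl_fun 2 (H x))
    (has_partial_shift (eps *: e k) H x)) (has_partial_shift (- (eps *: e k)) H x)))
  (is_derive_cst_fun _ _ _)) _.
by rewrite mulr0 addr0.
Qed.

Lemma has_partial_transport eps u j s i : (forall k, is_jet (u k)) ->
  has_partial i (transport eps u j s) (transport eps u j (i :: s)).
Proof.
move=> ju x; rewrite /transport.
apply: is_derive_val (is_derive_sum_fun _ (fun k : 'I_d => is_deriveD_fun
  (is_deriveM_fun (ju k [::] i x) (has_partial_cdiff eps k (ju j s i) x))
  (is_derive_sum_fun _ (fun p => is_deriveM_fun (ju k p.1 i x)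
      (has_partial_cdiff eps k (ju j p.2 i) x))))) _.
apply: eq_bigr => k _; rewrite big_split/= big_cons big_cat/= !big_map.
ring.
Qed.

Lemma is_jet_step eps u g j : (forall k, is_jet (u k)) -> is_jet (g j) ->
  is_jet (step eps u g j).
Proof.
move=> ju jg s i x; rewrite /step.
exact: is_deriveD_fun (is_deriveB_fun (has_partial_avg eps (ju j s i) x)
  (is_deriveMl_fun _ (has_partial_transport eps j s i ju x)))
  (is_deriveMl_fun _ (jg s i x)).
Qed.

Lemma is_jet_scheme eps u0 g n j : (forall k, is_jet (u0 k)) ->
  (forall m k, is_jet (g (m%:R * tau d nu eps) k)) -> is_jet (scheme eps u0 g n j).
Proof.
by move=> ju jg; elim: n j => [|n ih] j //=; apply: is_jet_step.
Qed.

Context (eps : R).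
Hypotheses (d0 : (0 < d)%N) (nu0 : 0 < nu) (eps0 : 0 < eps).

Let dR0 : 0 < d%:R :> R. Proof. by rewrite ltr0n. Qed.

Lemma tau_gt0 : 0 < tau d nu eps.
Proof. by rewrite /tau divr_gt0 ?exprn_gt0 ?mulr_gt0. Qed.

Lemma tau_le : eps <= 4 * d%:R * nu -> tau d nu eps <= eps.
Proof.
by move=> h; rewrite /tau ler_pdivrMr ?mulr_gt0// expr2 ler_pM2l.
Qed.

(* For small eps the left-hand side is a convex combination of values of f. *)
Lemma avg_transport_le (B M : R) (b : 'I_d -> R) (f : E -> R) x :
  eps * B <= 2 * nu -> (forall i, `|b i| <= B) -> (forall y, `|f y| <= M) ->
  `|avg eps f x - tau d nu eps * \sum_(i < d) b i * cdiff eps i f x| <= M.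
Proof.
move=> epsB bB fM.
have D0 := dR0; have e0 := eps0; have n0 := nu0.
rewrite /avg mulr_suml mulr_sumr -sumrB.
rewrite (_ : M = d%:R * (M / d%:R)); last by rewrite mulrCA divff ?gt_eqF// mulr1.
apply: norm_sum_ord_le => i.
set fp := f (x + _); set fm := f (x - _).
(* With this rescaled drift the three weights are 2, 1 + w and 1 - w over 4, nonnegative as soon as
   |w| <= 1; this is the condition [epsB]. *)
pose w := eps * b i / (2 * nu).
have w1 : `|w| <= 1.
  rewrite /w normrM (ger0_norm (_ : 0 <= (2 * nu)^-1)); last by rewrite invr_ge0; lra.
  rewrite ler_pdivrMr; last by lra.
  rewrite mul1r normrM gtr0_norm//; apply: le_trans epsB.
  by rewrite ler_wpM2l//; exact: ltW.
rewrite (_ : _ - _ = (2 * f x + (1 - w) * fp + (1 + w) * fm) / (4 * d%:R)); last first.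
  by rewrite /w /tau /cdiff -/fp -/fm; field; rewrite !gt_eqF.
rewrite normrM (ger0_norm (_ : 0 <= (4 * d%:R)^-1)); last by rewrite invr_ge0; lra.
rewrite ler_pdivrMr; last by lra.
rewrite (_ : _ * (4 * d%:R) = 4 * M); last by field; rewrite gt_eqF.
have := fM x; have := fM (x + eps *: e i); have := fM (x - eps *: e i).
rewrite -/fp -/fm => /ler_normlP[a1 a2] /ler_normlP[b1 b2] /ler_normlP[c1 c2].
move/ler_normlP : w1 => [w1 w2].
apply/ler_normlP; split; nra.
Qed.

End Scheme.

(** * The two-point maximum principle *)

Section Barrier.
Context {R : realType} {d : nat}.
Local Notation E := 'rV[R]_d.
Local Notation e := (@unit_vec R d).
Implicit Types (i j : 'I_d) (s : seq 'I_d) (x y : E).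
Context (nu eps : R).
Hypotheses (d0 : (0 < d)%N) (nu0 : 0 < nu) (eps0 : 0 < eps).

(* A two-point maximum principle: the walks started at x + r e_i and x are
   reflected in direction i and moved in parallel in the other directions, so
   the concave barrier L r - kappa r^2 absorbs the forcing F. Only increments r
   in 2 eps Z are compared, because for those the reflected walks never cross. *)
Lemma barrier (J : Type) (W F : nat -> J -> E -> R) (N : nat)
    (M Phi B L0 L kappa : R) :
  0 < kappa -> 0 <= B -> 0 <= Phi -> Phi + B * L <= 4 * nu * kappa ->
  0 <= L0 -> 2 * L0 <= L -> 32 * M * kappa <= 3 * L ^+ 2 -> 8 * eps * kappa <= L ->
  (forall n a x, (n < N)%N -> W n.+1 a x = avg eps (W n a) x + tau d nu eps * F n a x) ->
  (forall n a x, (n <= N)%N -> `|W n a x| <= M) ->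
  (forall n, (n < N)%N -> (forall a i x, `|cdiff eps i (W n a) x| <= L) ->
     forall a x, `|F n a x| <= Phi + B * L) ->
  (forall a i x r, `|W 0%N a (x + r *: e i) - W 0%N a x| <= L0 * `|r|) ->
  forall n a i x, (n <= N)%N -> `|cdiff eps i (W n a) x| <= L.
Proof.
move=> kap0 B0 Phi0 kapL L00 L0L ML epsL WS WM FB W0.
have e0 := eps0; have n0 := nu0; have t0 := tau_gt0 d0 nu0 eps0.
have D0 : 0 < d%:R :> R by rewrite ltr0n.
pose om (r : R) := L * r - kappa * r ^+ 2.
pose rr (m : nat) : R := 2 * eps * m%:R.
(* Only increments up to L / (2 kappa), where [om] has its maximum, are propagated by the
   induction. *)
pose P n := forall a i x m, 2 * kappa * rr m <= L ->
  `|W n a (x + rr m *: e i) - W n a x| <= om (rr m).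
have rr0 m : 0 <= rr m by rewrite !mulr_ge0// ltW.
have rrS m : rr m.+1 = rr m + 2 * eps by rewrite /rr -natr1; ring.
(* A reflected pair can land one lattice step past the maximum of [om]. There the trivial bound 2 M
   suffices: the overshoot [z] is at most 4 eps kappa <= L / 2, so kappa * om >= 3 L^2 / 16 >= 2 M
   kappa. The numerical constants of the hypotheses come from here. *)
have Pext n : (n <= N)%N -> P n -> forall a i x m, 2 * kappa * (rr m - 2 * eps) <= L ->
    `|W n a (x + rr m *: e i) - W n a x| <= om (rr m).
  move=> nN Pn a i x m Hm; have [/Pn//|Lm] := leP (2 * kappa * rr m) L.
  apply: (@le_trans _ _ (2 * M)).
    apply: le_trans (ler_normB _ _) _.
    have := WM n a (x + rr m *: e i) nN; have := WM n a x nN; lra.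
  rewrite -(ler_pM2l kap0) /om.
  set r := rr m in Hm Lm *.
  pose z := 2 * kappa * r - L.
  have z0 : 0 <= z by rewrite /z; lra.
  have z1 : z <= L / 2 by rewrite /z; lra.
  have -> : kappa * (L * r - kappa * r ^+ 2) = (L ^+ 2 - z ^+ 2) / 4.
    by rewrite /z; field.
  have : z ^+ 2 <= (L / 2) ^+ 2 by rewrite lerXn2r// nnegrE//; lra.
  have -> : (L / 2) ^+ 2 = L ^+ 2 / 4 by field.
  by lra.
have Pcdiff n : P n -> forall a i x, `|cdiff eps i (W n a) x| <= L.
  move=> Pn a i x; have := Pn a i (x - eps *: e i) 1%N.
  have r1 : rr 1%N = eps + eps by rewrite /rr; ring.
  rewrite r1 scalerDl addrA subrK /om => H.
  have {}H := H ltac:(lra).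
  rewrite /cdiff normrM (ger0_norm (_ : 0 <= (2 * eps)^-1)); last first.
    by rewrite invr_ge0; lra.
  rewrite ler_pdivrMr; last by lra.
  apply: le_trans H _.
  have : 0 <= kappa * (eps + eps) ^+ 2 by rewrite mulr_ge0 ?sqr_ge0// ltW.
  by lra.
suff HP n : (n <= N)%N -> P n by move=> n a i x nN; exact: Pcdiff (HP n nN) _ _ _.
elim: n => [_ a i x m Hm|n ih nN].
  apply: le_trans (W0 _ _ _ _) _; rewrite ger0_norm// /om.
  have h1 : 0 <= rr m * (L - 2 * L0) by rewrite mulr_ge0//; lra.
  have h2 : 0 <= rr m * (L - 2 * kappa * rr m) by rewrite mulr_ge0//; lra.
  by rewrite expr2; lra.
have Pn := ih (ltnW nN); have Pe := Pext n (ltnW nN) Pn.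
have FL := FB n nN (Pcdiff n Pn).
(* At m = 0 both sides vanish. From m.+1 on, the approaching pair is at distance r - 2 eps, still a
   nonnegative multiple of 2 eps. *)
move=> a i x [_|m Hm]; first by rewrite /om /rr mulr0 scale0r addr0 subrr normr0 mulr0 expr0n/= mulr0 subrr.
set r := rr m.+1 in Hm *.
have rm : r = rr m + 2 * eps by exact: rrS.
rewrite !WS//; set y := x + r *: e i.
rewrite (_ : _ - _ = (avg eps (W n a) y - avg eps (W n a) x)
   + tau d nu eps * (F n a y - F n a x)); last by ring.
apply: le_trans (ler_normD _ _) _.
rewrite normrM (gtr0_norm t0).
have Hf : tau d nu eps * `|F n a y - F n a x| <= tau d nu eps * (2 * (4 * nu * kappa)).
  rewrite ler_pM2l//; apply: le_trans (ler_normB _ _) _.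
  have := FL a x; have := FL a y; lra.
pose T (j : 'I_d) z := 2 * W n a z + W n a (z + eps *: e j) + W n a (z - eps *: e j).
have Hr : `|W n a y - W n a x| <= om r by apply: Pn.
have Tj j : `|T j y - T j x| <= 4 * om r.
  have A1 : y + eps *: e j = (x + eps *: e j) + r *: e i by rewrite /y addrAC.
  have A2 : y - eps *: e j = (x - eps *: e j) + r *: e i by rewrite /y addrAC.
  have := Pn a i (x + eps *: e j) m.+1 Hm; have := Pn a i (x - eps *: e j) m.+1 Hm.
  rewrite -/r -A1 -A2 /T.
  set q1 := W n a (y - _); set q2 := W n a (x - _).
  set q3 := W n a (y + _); set q4 := W n a (x + _) => H1 H2.
  rewrite (_ : _ - _ = 2 * (W n a y - W n a x) + (q1 - q2) + (q3 - q4)); last by ring.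
  apply: le_trans (ler_normD _ _) _.
  apply: le_trans (lerD (ler_normD _ _) (lexx _)) _.
  by rewrite normrM (ger0_norm (_ : 0 <= 2))//; lra.
(* In direction i, y + eps e_i is paired with x - eps e_i and y - eps e_i with x + eps e_i, at
   distances r + 2 eps and r - 2 eps. The second difference of the concave [om] gives the gain 8
   kappa eps^2. *)
have Ti : `|T i y - T i x| <= 4 * om r - 8 * kappa * eps ^+ 2.
  have H1 : `|W n a (y + eps *: e i) - W n a (x - eps *: e i)| <= om (rr m.+2).
    have -> : y + eps *: e i = (x - eps *: e i) + rr m.+2 *: e i.
      rewrite rrS -/r mulrDl mul1r !scalerDl /y.
      set v := eps *: e i; set w := r *: e i.
      by rewrite (addrC w (v + v)) -!addrA addKr (addrC v).
    by apply: Pe; rewrite rrS -/r; lra.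
  have H2 : `|W n a (y - eps *: e i) - W n a (x + eps *: e i)| <= om (rr m).
    have -> : y - eps *: e i = (x + eps *: e i) + rr m *: e i.
      rewrite /y rm mulrDl mul1r !scalerDl.
      by rewrite !addrA addrK addrAC.
    apply: Pn; apply: le_trans Hm; rewrite -/r rm.
    have := mulr_gt0 kap0 e0; lra.
  move: H1 H2; rewrite /T.
  set q1 := W n a (y - _); set q2 := W n a (x - _).
  set q3 := W n a (y + _); set q4 := W n a (x + _) => H1 H2.
  rewrite (_ : _ - _ = 2 * (W n a y - W n a x) + (q3 - q2) + (q1 - q4)); last by ring.
  apply: le_trans (ler_normD _ _) _.
  apply: le_trans (lerD (ler_normD _ _) (lexx _)) _.
  rewrite normrM (ger0_norm (_ : 0 <= 2))//.
  have -> : 4 * om r - 8 * kappa * eps ^+ 2 = 2 * om r + om (rr m.+2) + om (rr m).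
    by rewrite /om rrS -/r rm; ring.
  by lra.
have Havg : `|avg eps (W n a) y - avg eps (W n a) x| <=
    (4 * d%:R * om r - 8 * kappa * eps ^+ 2) / (4 * d%:R).
  rewrite /avg -mulrBl -sumrB normrM (ger0_norm (_ : 0 <= (4 * d%:R)^-1)); last first.
    by rewrite invr_ge0; lra.
  rewrite ler_pM2r ?invr_gt0; last by lra.
  rewrite (bigD1 i)//=; apply: le_trans (ler_normD _ _) _.
  apply: (@le_trans _ _ ((4 * om r - 8 * kappa * eps ^+ 2) + \sum_(j < d | j != i) 4 * om r)).
    apply: lerD; first exact: Ti.
    by apply: le_trans (ler_norm_sum _ _ _) _; apply: ler_sum => j _; exact: Tj.
  have Hs : 4 * om r + \sum_(j < d | j != i) 4 * om r = d%:R * (4 * om r).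
    transitivity (\sum_(j < d) 4 * om r); first by rewrite [RHS](bigD1 i).
    by rewrite sumr_const card_ord -[LHS]mulr_natl.
  lra.
(* After division by 4 d the gain is 2 kappa eps^2 / d, exactly [tau] times twice the bound 4 nu
   kappa on the forcing, so the sum is [om r]. *)
apply: le_trans (lerD Havg Hf) _.
rewrite le_eqVlt; apply/orP; left; apply/eqP; rewrite /tau; field.
by rewrite !gt_eqF.
Qed.

End Barrier.

(** * A priori bounds *)

Section Bounds.
Context {R : realType} {d : nat} (nu : R) (d0 : (0 < d)%N) (nu0 : 0 < nu).
Local Notation E := 'rV[R]_d.
Local Notation e := (@unit_vec R d).
Local Notation jet := ('I_d -> seq 'I_d -> E -> R).
Implicit Types (i j : 'I_d) (s : seq 'I_d) (x y : E) (u : jet) (eps : R).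

Definition transport_rest eps u j s x : R :=
  \sum_(i < d) \sum_(p <- proper_splits s) u i p.1 x * cdiff eps i (u j p.2) x.

Lemma transportE eps u j s x : transport eps u j s x =
  \sum_(i < d) u i [::] x * cdiff eps i (u j s) x + transport_rest eps u j s x.
Proof. by rewrite /transport big_split. Qed.

Lemma transport_rest_le eps u j s x (c : R) : 0 <= c ->
  (forall i p, p \in proper_splits s ->
     `|u i p.1 x * cdiff eps i (u j p.2) x| <= c) ->
  `|transport_rest eps u j s x| <= d%:R * (2 ^+ size s * c).
Proof.
move=> c0 H; apply: norm_sum_ord_le => i.
apply: le_trans (norm_sum_le (fun p => H i p)) _.
by rewrite ler_wpM2r// -natrX ler_nat size_proper_splits.
Qed.

(** The leading transport term is part of the convex combination and costs nothing; only the
    lower-order products and the forcing enlarge the bound. *)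
Lemma step_le eps u (g : jet) j s x (B Z Q b : R) : 0 < eps ->
  eps * B <= 2 * nu -> (forall i, `|u i [::] x| <= B) ->
  (forall y, `|u j s y| <= Z) -> `|transport_rest eps u j s x| <= Q ->
  `|g j s x| <= b -> `|step nu eps u g j s x| <= Z + tau d nu eps * (Q + b).
Proof.
move=> eps0 epsB uB uZ rQ gb; have t0 := tau_gt0 d0 nu0 eps0.
rewrite /step transportE.
have H1 := avg_transport_le d0 nu0 eps0 x epsB uB uZ.
set a := avg _ _ _; set b1 := \sum_(i < d) _ in H1 *.
rewrite (_ : _ + _ = (a - tau d nu eps * b1)
  + (tau d nu eps * (g j s x - transport_rest eps u j s x))); last by ring.
apply: le_trans (ler_normD _ _) _; apply: lerD => //.
rewrite normrM gtr0_norm// ler_pM2l//.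
by apply: le_trans (ler_normB _ _) _; rewrite addrC lerD.
Qed.

(* A k and B k bound the k-th derivatives of the initial value and of the
   forcing up to time T; M is the resulting bound on the solution itself. *)
Record admissible (M : R) (A B : nat -> R) (T : R) (u0 : jet) (g : R -> jet) : Prop :=
  Admissible {
    init_jet : forall j, is_jet (u0 j);
    forcing_jet : forall t j, 0 <= t -> is_jet (g t j);
    init_le : forall j s x, `|u0 j s x| <= A (size s);
    forcing_le : forall t j s x, 0 <= t -> t <= T -> `|g t j s x| <= B (size s);
    horizon_ge0 : 0 <= T;
    max_le : A 0%N + T * B 0%N <= M }.

Context (M : R) (A B : nat -> R).
Hypotheses (A0 : forall k, 0 <= A k) (B0 : forall k, 0 <= B k).

Section Fixed.
Context (T : R) (u0 : jet) (g : R -> jet).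
Hypothesis adm : admissible M A B T u0 g.
Local Notation tau := (tau d nu).
Local Notation U eps := (scheme nu eps u0 g).

Lemma is_jet_U eps n j : 0 < eps -> is_jet (U eps n j).
Proof.
move=> eps0; apply: is_jet_scheme => [k|m k]; first exact: init_jet adm k.
by apply: (forcing_jet adm); rewrite mulr_ge0// ltW// tau_gt0.
Qed.

Lemma time_le eps n m : 0 < eps -> (m <= n)%N -> n%:R * tau eps <= T ->
  m%:R * tau eps <= T.
Proof.
move=> eps0 mn; apply: le_trans.
by rewrite ler_wpM2r ?ler_nat// ltW// tau_gt0.
Qed.

Lemma g_le eps n j s x : 0 < eps -> n%:R * tau eps <= T ->
  `|g (n%:R * tau eps) j s x| <= B (size s).
Proof.
by move=> eps0; apply: (forcing_le adm); rewrite mulr_ge0// ltW// tau_gt0.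
Qed.

Lemma max_ge0 : 0 <= M.
Proof.
apply: le_trans (max_le adm); rewrite addr_ge0// mulr_ge0//.
exact: horizon_ge0 adm.
Qed.

(** For the empty word there are no lower-order products, so the bound grows by [tau * B 0] per
    step. Up to the horizon it stays below [M], which keeps the drift small enough for the next
    step. *)
Lemma scheme_max eps n j x : 0 < eps -> eps * M <= 2 * nu ->
  n%:R * tau eps <= T -> `|U eps n j [::] x| <= M.
Proof.
move=> eps0 epsM nT; have t0 := tau_gt0 d0 nu0 eps0.
have HM m : m%:R * tau eps <= T -> A 0%N + m%:R * tau eps * B 0%N <= M.
  by move=> mT; apply: le_trans (max_le adm); rewrite lerD2l ler_wpM2r.
apply: le_trans (HM _ nT).
elim: n nT j x => [|n ih] nT j x.
  by rewrite mul0r mul0r addr0; exact: (init_le adm j [::]).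
have nT' := time_le eps0 (leqnSn n) nT.
have ihn := ih nT'.
have -> : A 0%N + n.+1%:R * tau eps * B 0%N
    = (A 0%N + n%:R * tau eps * B 0%N) + tau eps * (0 + B 0%N).
  by rewrite -natr1; ring.
apply: (step_le (B := M)) => //.
- by move=> i; apply: le_trans (ihn _ _) (HM _ nT').
- by rewrite /transport_rest big1 ?normr0// => i _; rewrite big_nil.
- exact: (g_le j [::]).
Qed.

End Fixed.

(** Both [L] and the threshold on eps are fixed before [T] and the data, which is the source of the
    independence of the horizon. Only the leading transport term sees [L]: in every other product
    both factors involve derivatives of order at most k, bounded by [C]. *)
Lemma barrier_step (k : nat) (C : R) : 0 <= C ->
  exists L : R, 0 <= L /\
  \forall eps \near 0^'+, forall T u0 g, admissible M A B T u0 g ->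
    forall N, N%:R * tau d nu eps <= T ->
    (forall n j s x, (n <= N)%N -> (size s <= k)%N ->
       `|scheme nu eps u0 g n j s x| <= C) ->
    forall n j s i x, (n <= N)%N -> size s = k ->
       `|cdiff eps i (scheme nu eps u0 g n j s) x| <= L.
Proof.
move=> C0; have n0 := nu0.
have D0 : 0 < d%:R :> R by rewrite ltr0n.
have [Phi ePhi] : exists r, r = d%:R * (2 ^+ k * C ^+ 2) + B k by eexists.
have Phi0 : 0 <= Phi by rewrite ePhi addr_ge0// !mulr_ge0// ?exprn_ge0// ltW.
(* The first summand accommodates the initial slope. The second gives L >= 1, so that 32 C kappa <=
   (8 C (Phi + 1 + d C) / nu) L, which the third bounds by L^2. *)
have [L eL] : exists r, r = 2 * A k.+1 + 1 + 8 * C * (Phi + 1 + d%:R * C) / nu.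
  by eexists.
have [kappa ek] : exists r, r = (Phi + d%:R * C * L + 1) / (4 * nu) by eexists.
have DC : 0 <= d%:R * C by rewrite mulr_ge0// ltW.
have AL : 0 <= 8 * C * (Phi + 1 + d%:R * C) / nu.
  by rewrite divr_ge0 ?(ltW nu0)// mulr_ge0 ?mulr_ge0// !addr_ge0.
have Ak := A0 k.+1.
have L1 : 1 <= L by rewrite eL; lra.
have kap0 : 0 < kappa.
  rewrite ek divr_gt0 ?mulr_gt0//; have := mulr_ge0 DC (le_trans ler01 L1); lra.
exists L; split; first by lra.
have e1 : 0 < L / (8 * kappa) by rewrite divr_gt0 ?mulr_gt0//; lra.
near=> eps => T u0 g adm N NT UC n j s i x nN sk.
have eps0 : 0 < eps by near: eps; exact: nbhs_right_gt.
have epsL : eps <= L / (8 * kappa) by near: eps; exact: nbhs_right_le.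
have jU m l : is_jet (scheme nu eps u0 g m l) by exact: (is_jet_U adm).
pose W m (a : 'I_d * k.-tuple 'I_d) := scheme nu eps u0 g m a.1 a.2.
pose F m (a : 'I_d * k.-tuple 'I_d) y := g (m%:R * tau d nu eps) a.1 a.2 y
  - transport eps (scheme nu eps u0 g m) a.1 a.2 y.
have ss : size s == k by rewrite sk.
have := @barrier R d nu eps d0 nu0 eps0 _ W F N C Phi (d%:R * C) (A k.+1) L kappa kap0
  DC Phi0 _ (A0 _) _ _ _ _ _ _ _ n (j, Tuple ss) i x nN; apply.
- by rewrite ek mulrCA divff ?mulr1//; lra.
- by rewrite eL; lra.
- have h : C * (Phi + d%:R * C * L + 1) <= C * (Phi + 1 + d%:R * C) * L.
    rewrite -[leRHS]mulrA ler_wpM2l//.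
    have : 0 <= (Phi + 1) * (L - 1) by rewrite mulr_ge0//; lra.
    by lra.
  have -> : 32 * C * kappa = 8 * (C * (Phi + d%:R * C * L + 1)) / nu.
    by rewrite ek; field; lra.
  have h1 : 8 * (C * (Phi + d%:R * C * L + 1)) / nu
      <= 8 * C * (Phi + 1 + d%:R * C) / nu * L.
    rewrite [leRHS](_ : _ = 8 * (C * (Phi + 1 + d%:R * C) * L) / nu); last by ring.
    by rewrite ler_wpM2r ?invr_ge0 ?(ltW nu0)//; lra.
  have h2 : 8 * C * (Phi + 1 + d%:R * C) / nu * L <= L * L.
    by rewrite ler_wpM2r//; lra.
  have := sqr_ge0 L; rewrite expr2; lra.
- by rewrite -mulrA mulrCA -ler_pdivlMr// mulr_gt0.
- move=> m a y mN; rewrite /W/= /step /F; ring.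
- by move=> m a y mN; apply: UC; rewrite ?size_tuple.
- move=> m mN HL a y; rewrite /F transportE.
  have mT : m%:R * tau d nu eps <= T by exact: time_le eps0 (ltnW mN) NT.
  set t1 := \sum_(_ < d) _; set t2 := transport_rest _ _ _ _ _.
  have b1 : `|t1| <= d%:R * C * L.
    rewrite -mulrA; apply: norm_sum_ord_le => l; rewrite normrM.
    by apply: ler_pM => //; [apply: UC => //; exact: ltnW|exact: HL].
  have b2 : `|t2| <= d%:R * (2 ^+ k * C ^+ 2).
    rewrite -[X in 2 ^+ X](size_tuple a.2).
    apply: transport_rest_le; first exact: sqr_ge0.
    move=> l p /proper_splitsP [p1 p2 _]; rewrite size_tuple in p2.
    rewrite normrM expr2; apply: ler_pM => //.
      by apply: UC; [exact: ltnW|rewrite -p2 leq_addr].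
    apply: cdiff_le (jU m a.1 p.2 l) _ => //.
    move=> z; apply: UC; first exact: ltnW.
    by rewrite /= -p2 -addn1 addnC leq_add2r.
  have b3 : `|g (m%:R * tau d nu eps) a.1 a.2 y| <= B k.
    by rewrite -[X in B X](size_tuple a.2); apply: (g_le adm).
  apply: le_trans (ler_normB _ _) _; rewrite ePhi.
  have := ler_normD t1 t2; lra.
- move=> a l y r.
  apply: taylor1 (init_jet adm a.1 a.2 l) _ => z.
  by apply: le_trans (init_le adm _ _ _) _; rewrite /= size_tuple.
Unshelve. all: by end_near. Qed.

(** Induction on the order, with a discrete Gronwall argument at each order. The recursion must be
    linear in the top-order derivatives; the dangerous product, where all of [s] falls on [u i], is
    linear because the remaining factor [cdiff] of [u j [::]] is bounded by [barrier_step] at order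
    0. *)
Lemma crude_bound (T : R) (u0 : jet) (g : R -> jet) (k : nat) :
  admissible M A B T u0 g ->
  exists C : R, 0 <= C /\
  \forall eps \near 0^'+, forall n j s x,
    n%:R * tau d nu eps <= T -> (size s <= k)%N ->
    `|scheme nu eps u0 g n j s x| <= C.
Proof.
move=> adm; have n0 := nu0; have M0 := max_ge0 adm.
have small (C : R) : 0 <= C -> \forall eps \near 0^'+, eps * C <= 2 * nu.
  move=> C0; near=> eps.
  have eps0 : 0 < eps by near: eps; exact: nbhs_right_gt.
  apply: (@le_trans _ _ (eps * (C + 1))); first by rewrite ler_pM2l//; lra.
  rewrite -ler_pdivlMr; last by lra.
  by near: eps; apply: nbhs_right_le; rewrite divr_gt0//; lra.
have base : \forall eps \near 0^'+, forall n j s x,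
    n%:R * tau d nu eps <= T -> (size s <= 0)%N -> `|scheme nu eps u0 g n j s x| <= M.
  near=> eps => n j s x nT; rewrite leqn0 size_eq0 => /eqP ->.
  have eps0 : 0 < eps by near: eps; exact: nbhs_right_gt.
  have epsM : eps * M <= 2 * nu by near: eps; exact: small.
  exact: (scheme_max adm j x eps0 epsM nT).
elim: k => [|k [C [C0 HC]]]; first by exists M.
have [L [L0 HL]] := barrier_step 0 M0.
pose C1 := C + L + 1.
pose a := d%:R * (2 ^+ k.+1 * C1) + 1.
(* [Y] dominates the initial value, the lower-order bounds and the forcing, so that in the recursion
   each of them is absorbed by the running bound [Z >= Y]. *)
pose Y := A k.+1 + C1 + B k.+1.
have Ak := A0 k.+1; have Bk := B0 k.+1.
have C10 : 0 <= C1 by rewrite /C1; lra.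
have a0 : 0 <= a by rewrite addr_ge0// !mulr_ge0// exprn_ge0.
have Y0 : 0 <= Y by rewrite /Y; lra.
exists (C + Y * expR (a * T)); split; first by rewrite addr_ge0// mulr_ge0// expR_ge0.
near=> eps => n j s x nT.
have eps0 : 0 < eps by near: eps; exact: nbhs_right_gt.
have t0 := tau_gt0 d0 nu0 eps0.
have HC' : forall n j s x, n%:R * tau d nu eps <= T -> (size s <= k)%N ->
    `|scheme nu eps u0 g n j s x| <= C by near: eps.
have jU m l : is_jet (scheme nu eps u0 g m l) by exact: (is_jet_U adm).
rewrite leq_eqVlt => /orP[/eqP|]; last first.
  move/(HC' _ j s x nT)/le_trans; apply; rewrite lerDl mulr_ge0// expR_ge0//.
have HL' n' j' i' x' : n'%:R * tau d nu eps <= T ->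
    `|cdiff eps i' (scheme nu eps u0 g n' j' [::]) x'| <= L.
  move=> n'T.
  have H : forall T u0 g, admissible M A B T u0 g ->
    forall N, N%:R * tau d nu eps <= T ->
    (forall n j s x, (n <= N)%N -> (size s <= 0)%N ->
       `|scheme nu eps u0 g n j s x| <= M) ->
    forall n j s i x, (n <= N)%N -> size s = 0%N ->
       `|cdiff eps i (scheme nu eps u0 g n j s) x| <= L by near: eps.
  apply: (H T u0 g adm n' n'T) => // m l w y mn' w0.
  have Hb : forall n j s x, n%:R * tau d nu eps <= T -> (size s <= 0)%N ->
    `|scheme nu eps u0 g n j s x| <= M by near: eps.
  by apply: Hb => //; exact: time_le eps0 mn' n'T.
have epsC : eps * C <= 2 * nu by near: eps; exact: small.
move=> sk; apply: (@le_trans _ _ (Y * (1 + tau d nu eps * a) ^+ n)); last first.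
  apply: (@le_trans _ _ (Y * expR (a * T))); last by rewrite lerDr.
  rewrite ler_wpM2l//; apply: (@le_trans _ _ (expR (tau d nu eps * a) ^+ n)).
    rewrite lerXn2r// ?nnegrE ?expR_ge0// ?expR_ge1Dx//.
    by rewrite addr_ge0// mulr_ge0// ltW.
  rewrite -expRM_natl ler_expR mulrA mulrC ler_wpM2l//.
elim: n j s x nT sk => [|n ih] j s x nT sk.
  rewrite expr0 mulr1; apply: le_trans (init_le adm _ _ _) _.
  by rewrite sk /Y; lra.
have nT' := time_le eps0 (leqnSn n) nT.
set Z := Y * (1 + tau d nu eps * a) ^+ n in ih *.
have YZ : Y <= Z.
  rewrite /Z ler_peMr// exprn_ege1// lerDl mulr_ge0// ltW//.
have C1Z : C1 <= Z by apply: le_trans YZ; rewrite /Y; lra.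
have -> : Y * (1 + tau d nu eps * a) ^+ n.+1
    = Z + tau d nu eps * (d%:R * (2 ^+ k.+1 * (C1 * Z)) + Z).
  by rewrite /Z exprSr /a; ring.
apply: (step_le (B := C)) => //.
- by move=> i; apply: HC'.
- by move=> y; apply: ih.
- rewrite -[X in 2 ^+ X]sk; apply: transport_rest_le.
    by rewrite mulr_ge0//; lra.
  move=> i p /proper_splitsP [p1 p2 p3]; rewrite sk in p2.
  rewrite normrM; case: (eqVneq p.2 [::]) => [p20|p20].
    rewrite p20 p3// mulrC; apply: ler_pM => //; last exact: ih.
    by apply: le_trans (HL' _ _ _ _ nT') _; rewrite /C1; lra.
  have p21 : (0 < size p.2)%N by rewrite lt0n size_eq0.
  apply: ler_pM => //.
    apply: (@le_trans _ _ C); last by rewrite /C1; lra.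
    by apply: HC' => //; rewrite -ltnS -p2 -addn1 leq_add2l.
  apply: cdiff_le (jU n j p.2 i) _ => // y.
  have [sk2|sk2] := leqP (size (i :: p.2)) k.
    by apply: le_trans (HC' _ _ _ _ nT' sk2) _; apply: le_trans C1Z; rewrite /C1; lra.
  apply: ih => //; apply/eqP; rewrite eqn_leq sk2 andbT.
  by rewrite /= -p2 -add1n leq_add2r.
- apply: le_trans (g_le adm j s x eps0 nT') _; rewrite sk.
  by apply: le_trans YZ; rewrite /Y; lra.
Unshelve. all: by end_near. Qed.

Lemma uniform_bound (k : nat) : 0 <= M ->
  exists C : R, 0 <= C /\
  forall T u0 g, admissible M A B T u0 g ->
  \forall eps \near 0^'+, forall n j s x,
    n%:R * tau d nu eps <= T -> (size s <= k)%N ->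
    `|scheme nu eps u0 g n j s x| <= C.
Proof.
move=> M0; have n0 := nu0.
elim: k => [|k [C [C0 HC]]].
  exists M; split => // T u0 g adm; near=> eps => n j s x nT.
  rewrite leqn0 size_eq0 => /eqP ->.
  have eps0 : 0 < eps by near: eps; exact: nbhs_right_gt.
  apply: (scheme_max adm) => //; apply: (@le_trans _ _ (eps * (M + 1))).
    by rewrite ler_pM2l//; lra.
  rewrite -ler_pdivlMr; last by lra.
  by near: eps; apply: nbhs_right_le; rewrite divr_gt0//; lra.
have [L [L0 HL]] := barrier_step k C0.
(* The summand 1 is room for [C2 * eps], the gap between the difference and the derivative. [C2]
   comes from [crude_bound] and depends on [T], but eps is taken small after it. *)
exists (C + L + 1); split; first by lra.
move=> T u0 g adm; have [C2 [C20 HC2]] := crude_bound k.+2 adm.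
near=> eps => n j s x nT.
have eps0 : 0 < eps by near: eps; exact: nbhs_right_gt.
have HC' : forall n j s x, n%:R * tau d nu eps <= T -> (size s <= k)%N ->
    `|scheme nu eps u0 g n j s x| <= C by near: eps; exact: HC.
rewrite leq_eqVlt => /orP[|]; last first.
  by move/(HC' _ j s x nT)/le_trans; apply; lra.
case: s => // i s /eqP isk; have sk : size s = k by case: isk.
have jU m l : is_jet (scheme nu eps u0 g m l) by exact: (is_jet_U adm).
have HC2' : forall n j s x, n%:R * tau d nu eps <= T -> (size s <= k.+2)%N ->
    `|scheme nu eps u0 g n j s x| <= C2 by near: eps.
have b1 : `|cdiff eps i (scheme nu eps u0 g n j s) x - scheme nu eps u0 g n j (i :: s) x|
    <= C2 * eps.
  apply: (cdiff_consistent x eps0 (jU n j s i) (jU n j (i :: s) i)) => y.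
  by apply: HC2' => //; rewrite -[size _]/(size s).+2 sk.
have b2 : `|cdiff eps i (scheme nu eps u0 g n j s) x| <= L.
  have H : forall T u0 g, admissible M A B T u0 g ->
    forall N, N%:R * tau d nu eps <= T ->
    (forall n j s x, (n <= N)%N -> (size s <= k)%N ->
       `|scheme nu eps u0 g n j s x| <= C) ->
    forall n j s i x, (n <= N)%N -> size s = k ->
       `|cdiff eps i (scheme nu eps u0 g n j s) x| <= L by near: eps.
  apply: (H T u0 g adm n nT) => // m l w y mn wk.
  by apply: HC' => //; exact: time_le eps0 mn nT.
have b3 : C2 * eps <= 1.
  apply: (@le_trans _ _ ((C2 + 1) * eps)); first by rewrite ler_pM2r//; lra.
  rewrite mulrC -ler_pdivlMr; last by lra.
  by near: eps; apply: nbhs_right_le; rewrite divr_gt0//; lra.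
have -> : scheme nu eps u0 g n j (i :: s) x = cdiff eps i (scheme nu eps u0 g n j s) x
  - (cdiff eps i (scheme nu eps u0 g n j s) x - scheme nu eps u0 g n j (i :: s) x) by ring.
apply: le_trans (ler_normB _ _) _; lra.
Unshelve. all: by end_near. Qed.

End Bounds.

(** * Consistency of the scheme *)

Section Generator.
Context {R : realType} {d : nat} (nu : R) (d0 : (0 < d)%N) (nu0 : 0 < nu).
Local Notation E := 'rV[R]_d.
Local Notation jet := ('I_d -> seq 'I_d -> E -> R).
Implicit Types (i j : 'I_d) (s : seq 'I_d) (x y : E) (u b : jet) (eps : R).

(* The s-th derivative of the j-th component of nu Laplacian u - u.grad u + b. *)
Definition generator u b j s x : R :=
  nu * \sum_(i < d) u j (i :: i :: s) x
  - \sum_(i < d) (u i [::] x * u j (i :: s) x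
      + \sum_(p <- proper_splits s) u i p.1 x * u j (i :: p.2) x)
  + b j s x.

Lemma norm_sum_splits_le s (F : seq 'I_d * seq 'I_d -> R) (k : nat) (c : R) :
  (size s <= k)%N -> 0 <= c ->
  (forall p, p \in proper_splits s -> `|F p| <= c) ->
  `|\sum_(p <- proper_splits s) F p| <= 2 ^+ k * c.
Proof.
move=> sk c0 H; apply: le_trans (norm_sum_le H) _.
rewrite ler_wpM2r// -natrX ler_nat.
by apply: leq_trans (size_proper_splits s) _; rewrite leq_pexp2l.
Qed.

Lemma splits_size s p (k : nat) : (size s <= k)%N -> p \in proper_splits s ->
  (size p.1 <= k)%N /\ (size p.2 < k)%N.
Proof.
move=> sk /proper_splitsP [p1 p2 _]; split.
  by apply: leq_trans sk; rewrite -p2 leq_addr.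
by apply: leq_trans sk; rewrite -p2 -add1n leq_add2r.
Qed.

(** Since [avg] minus the identity is exactly [tau * nu] times the sum of the [sdiff], the error
    consists of the consistency errors of [sdiff] and [cdiff]; the former calls for three
    derivatives beyond [s]. *)
Lemma step_generator (k : nat) (C : R) : 0 <= C ->
  exists K : R, 0 <= K /\ forall eps u b j s x, 0 < eps ->
    (forall j, is_jet (u j)) ->
    (forall j s y, (size s <= k.+3)%N -> `|u j s y| <= C) -> (size s <= k)%N ->
    `|step nu eps u b j s x - u j s x - tau d nu eps * generator u b j s x|
      <= tau d nu eps * (K * eps).
Proof.
move=> C0; have n0 := nu0; have D0 : 0 < d%:R :> R by rewrite ltr0n.
exists (nu * (d%:R * (2 * C)) + d%:R * (C * C + 2 ^+ k * (C * C))); split.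
  by rewrite addr_ge0// ?mulr_ge0// ?addr_ge0// ?mulr_ge0// ?exprn_ge0// ltW.
move=> eps u b j s x eps0 ju uC sk; have t0 := tau_gt0 d0 nu0 eps0.
have cd i w y : (size w <= k)%N -> `|cdiff eps i (u j w) y - u j (i :: w) y| <= C * eps.
  move=> wk; apply: (cdiff_consistent y eps0 (ju j w i) (ju j (i :: w) i)) => z.
  by apply: uC; rewrite /= !ltnS (leq_trans wk).
have Havg : avg eps (u j s) x - u j s x
    = tau d nu eps * (nu * \sum_(i < d) sdiff eps i (u j s) x).
  rewrite [X in _ - X](_ : _ = (\sum_(i < d) 4 * u j s x) / (4 * d%:R)); last first.
    by rewrite sumr_const card_ord -[_ *+ d]mulr_natl; field; rewrite gt_eqF.
  rewrite /avg -mulrBl -sumrB mulrA mulr_sumr mulr_suml; apply: eq_bigr => i _.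
  by rewrite /sdiff /tau; field; rewrite !gt_eqF.
have HE : step nu eps u b j s x - u j s x - tau d nu eps * generator u b j s x =
  tau d nu eps * (nu * \sum_(i < d) (sdiff eps i (u j s) x - u j (i :: i :: s) x)
   - \sum_(i < d) (u i [::] x * (cdiff eps i (u j s) x - u j (i :: s) x)
     + \sum_(p <- proper_splits s)
         u i p.1 x * (cdiff eps i (u j p.2) x - u j (i :: p.2) x))).
  rewrite sumrB.
  have -> : \sum_(i < d) (u i [::] x * (cdiff eps i (u j s) x - u j (i :: s) x)
     + \sum_(p <- proper_splits s)
         u i p.1 x * (cdiff eps i (u j p.2) x - u j (i :: p.2) x))
    = transport eps u j s x - \sum_(i < d) (u i [::] x * u j (i :: s) x
      + \sum_(p <- proper_splits s) u i p.1 x * u j (i :: p.2) x).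
    rewrite /transport -sumrB; apply: eq_bigr => i _.
    rewrite opprD addrACA -sumrB mulrBr; congr (_ + _).
    by apply: eq_bigr => p _; rewrite mulrBr.
  by rewrite /step /generator (_ : avg eps (u j s) x =
    u j s x + tau d nu eps * (nu * \sum_(i < d) sdiff eps i (u j s) x));
    [ring|rewrite -Havg; ring].
rewrite HE normrM (gtr0_norm t0) ler_wpM2l ?(ltW t0)//.
apply: le_trans (ler_normB _ _) _; rewrite mulrDl; apply: lerD.
  rewrite normrM (gtr0_norm n0) -!mulrA ler_wpM2l ?(ltW n0)//.
  apply: norm_sum_ord_le => i.
  rewrite mulrA.
  apply: (sdiff_consistent x eps0 (ju j s i) (ju j (i :: s) i) (ju j (i :: i :: s) i)) => z.
  by apply: uC; rewrite /= !ltnS.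
rewrite -mulrA; apply: norm_sum_ord_le => i; apply: le_trans (ler_normD _ _) _.
rewrite mulrDl; apply: lerD.
  by rewrite normrM -mulrA; apply: ler_pM => //; [exact: uC|exact: cd].
rewrite -mulrA; apply: norm_sum_splits_le => //.
  by rewrite !mulr_ge0// ltW.
move=> p /(splits_size sk) [p1 p2]; rewrite normrM -mulrA; apply: ler_pM => //.
  by apply: uC; rewrite (leq_trans p1)// -addn3 leq_addr.
by apply: cd; exact: ltnW.
Qed.

Lemma normB_mul_le (a b a' b' C delta : R) : `|b| <= C -> `|a'| <= C ->
  `|a - a'| <= delta -> `|b - b'| <= delta -> `|a * b - a' * b'| <= 2 * C * delta.
Proof.
move=> bC aC ad bd; rewrite (_ : _ - _ = (a - a') * b + a' * (b - b')); last by ring.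
apply: le_trans (ler_normD _ _) _; rewrite !normrM.
have H1 : `|a - a'| * `|b| <= delta * C by apply: ler_pM.
have H2 : `|a'| * `|b - b'| <= C * delta by apply: ler_pM.
lra.
Qed.

(** The generator is a quadratic polynomial in the jet, hence Lipschitz on bounded sets. *)
Lemma generator_lip (k : nat) (C : R) : 0 <= C ->
  exists K : R, 0 <= K /\ forall u u' b b' j s x (delta : R),
    (forall j s, (size s <= k.+2)%N -> `|u j s x| <= C) ->
    (forall j s, (size s <= k.+2)%N -> `|u' j s x| <= C) ->
    (forall j s, (size s <= k.+2)%N -> `|u j s x - u' j s x| <= delta) ->
    `|b j s x - b' j s x| <= delta -> (size s <= k)%N ->
    `|generator u b j s x - generator u' b' j s x| <= K * delta.
Proof.
move=> C0; have n0 := nu0; have D0 : 0 < d%:R :> R by rewrite ltr0n.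
exists (nu * d%:R + d%:R * (2 * C + 2 ^+ k * (2 * C)) + 1); split.
  by rewrite addr_ge0// addr_ge0// ?mulr_ge0// ?addr_ge0// ?mulr_ge0// ?exprn_ge0// ltW.
move=> u u' b b' j s x delta uC u'C uu bb sk.
have delta0 : 0 <= delta by apply: le_trans bb.
have prod i j' w w' : (size w <= k.+2)%N -> (size w' <= k.+2)%N ->
    `|u i w x * u j' w' x - u' i w x * u' j' w' x| <= 2 * C * delta.
  by move=> wk w'k; apply: normB_mul_le; auto.
rewrite /generator.
set A1 := \sum_(i < d) _; set A2 := \sum_(i < d) _; set A3 := \sum_(i < d) _.
set A4 := \sum_(i < d) _.
rewrite (_ : _ - _ = nu * (A1 - A3) + (A4 - A2) + (b j s x - b' j s x)); last by ring.
apply: le_trans (ler_normD _ _) _; rewrite (mulrDl _ 1 delta) mul1r; apply: lerD => //.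
rewrite (mulrDl _ _ delta).
apply: le_trans (ler_normD _ _) _; apply: lerD.
  rewrite normrM (gtr0_norm n0) -mulrA ler_wpM2l ?(ltW n0)// -sumrB.
  by apply: norm_sum_ord_le => i; apply: uu; rewrite /= !ltnS.
rewrite distrC -sumrB -mulrA; apply: norm_sum_ord_le => i.
rewrite opprD addrACA; apply: le_trans (ler_normD _ _) _; rewrite (mulrDl _ _ delta); apply: lerD.
  by apply: prod; rewrite //= ltnS (leq_trans sk).
rewrite -sumrB -mulrA; apply: norm_sum_splits_le => //; first by rewrite !mulr_ge0.
move=> p /(splits_size sk) [p1 p2]; apply: prod.
  by rewrite (leq_trans p1)// -addn2 leq_addr.
by rewrite /= ltnW// ltnS ltnW.
Qed.

Lemma generator0 j s x : generator (fun _ _ _ => 0) (fun _ _ _ => 0) j s x = 0.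
Proof.
rewrite /generator big1// mulr0 sub0r addr0 big1 ?oppr0// => i _.
by rewrite mul0r add0r big1// => p _; rewrite mul0r.
Qed.

Lemma generator_le (k : nat) (C : R) : 0 <= C ->
  exists K : R, 0 <= K /\ forall u b j s x,
    (forall j s, (size s <= k.+2)%N -> `|u j s x| <= C) ->
    `|b j s x| <= C -> (size s <= k)%N -> `|generator u b j s x| <= K.
Proof.
move=> C0; have [K [K0 HK]] := generator_lip k C0.
exists (K * C); split; first by rewrite mulr_ge0.
move=> u b j s x uC bC sk.
have := HK u (fun _ _ _ => 0) b (fun _ _ _ => 0) j s x C uC.
rewrite generator0 !subr0; apply => //.
- by move=> j' s' _; rewrite normr0.
- by move=> j' s' h; rewrite subr0; exact: uC.
Qed.

(** * Increments of the scheme in time *)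

Section TimeIncrements.
Context (M : R) (A B : nat -> R) (T : R) (u0 : jet) (g : R -> jet).
Hypotheses (A0 : forall k, 0 <= A k) (B0 : forall k, 0 <= B k).
Hypothesis adm : admissible M A B T u0 g.
Hypothesis g_lip : forall k : nat, exists L : R, 0 <= L /\
  forall t t' j s x, 0 <= t -> t <= t' -> t' <= T -> (size s <= k)%N ->
    `|g t' j s x - g t j s x| <= L * (t' - t).
Local Notation tau := (tau d nu).
Local Notation U eps := (scheme nu eps u0 g).

Lemma forcing_bound (k : nat) : exists C : R, 0 <= C /\
  forall t j s x, 0 <= t -> t <= T -> (size s <= k)%N -> `|g t j s x| <= C.
Proof.
exists (\sum_(l < k.+1) B l); split; first by apply: sumr_ge0.
move=> t j s x t0 tT sk; apply: le_trans (forcing_le adm _ _ _ t0 tT) _.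
have sk' : (size s < k.+1)%N by [].
by rewrite (bigD1 (Ordinal sk'))//= lerDl sumr_ge0.
Qed.

Lemma scheme_time_lip (k : nat) : exists K : R, 0 <= K /\
  \forall eps \near 0^'+, forall n l j s x, (n + l)%:R * tau eps <= T ->
    (size s <= k)%N -> `|U eps (n + l)%N j s x - U eps n j s x| <= K * (l%:R * tau eps).
Proof.
have [C1 [C10 HC1]] := crude_bound d0 nu0 A0 B0 k.+3 adm.
have [C2 [C20 HC2]] := forcing_bound k.
have C0 : 0 <= C1 + C2 by lra.
have [K1 [K10 HK1]] := step_generator k C10.
have [K2 [K20 HK2]] := generator_le k C0.
exists (K1 + K2); split; first by lra.
near=> eps => n l j s x nlT sk.
have eps0 : 0 < eps by near: eps; exact: nbhs_right_gt.
have eps1 : eps <= 1 by near: eps; exact: nbhs_right_le.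
have t0 := tau_gt0 d0 nu0 eps0.
have HC : forall n j s x, n%:R * tau eps <= T -> (size s <= k.+3)%N ->
    `|U eps n j s x| <= C1 by near: eps.
elim: l nlT => [|l ih] nlT; first by rewrite addn0 subrr normr0 !mul0r mulr0.
have nlT' : (n + l)%:R * tau eps <= T by apply: time_le nlT; rewrite // leq_add2l.
rewrite addnS (_ : _ - _ = (U eps (n + l).+1 j s x - U eps (n + l)%N j s x)
  + (U eps (n + l)%N j s x - U eps n j s x)); last by ring.
rewrite (_ : l.+1%:R * tau eps = tau eps + l%:R * tau eps); last by rewrite -natr1; ring.
rewrite mulrDr.
apply: le_trans (ler_normD _ _) _; apply: lerD; last exact: ih.
have b1 := HK1 eps (U eps (n + l)%N) (g ((n + l)%:R * tau eps)) j s x eps0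
  (fun j' => is_jet_U d0 nu0 adm (n + l)%N j' eps0) (fun j' s' y => HC _ j' s' y nlT') sk.
have b2 : `|generator (U eps (n + l)%N) (g ((n + l)%:R * tau eps)) j s x| <= K2.
  apply: HK2 => //.
    move=> j' s' sk'; apply: le_trans (HC _ _ _ _ nlT' (leqW sk')) _; lra.
  have nl0 : 0 <= (n + l)%:R * tau eps by rewrite mulr_ge0// ltW.
  have := HC2 _ j s x nl0 nlT' sk; lra.
move: b1; rewrite -[step nu eps _ _]/(U eps (n + l).+1).
set c := generator _ _ _ _ _ in b2 *; set p := U _ _ _ _ _; set q := U _ _ _ _ _ => b1.
rewrite (_ : p - q = (p - q - tau eps * c) + tau eps * c); last by ring.
apply: le_trans (ler_normD _ _) _; rewrite mulrDl; apply: lerD.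
  apply: le_trans b1 _; rewrite mulrC ler_wpM2r ?(ltW t0)// -[leRHS]mulr1.
  by rewrite ler_wpM2l.
by rewrite normrM gtr0_norm// mulrC ler_wpM2r// ltW.
Unshelve. all: by end_near. Qed.

(** The generator is frozen at step n. At step n + m it has moved by O(m tau), the jet and the
    forcing being Lipschitz in time, and summation over m < l gives the quadratic error. *)
Lemma scheme_time_expansion (k : nat) : exists K : R, 0 <= K /\
  \forall eps \near 0^'+, forall n l j s x, (n + l)%:R * tau eps <= T ->
    (size s <= k)%N ->
    `|U eps (n + l)%N j s x - U eps n j s x
       - l%:R * tau eps * generator (U eps n) (g (n%:R * tau eps)) j s x|
    <= l%:R * tau eps * (K * (eps + l%:R * tau eps)).
Proof.
have [C1 [C10 HC1]] := crude_bound d0 nu0 A0 B0 k.+3 adm.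
have [K1 [K10 HK1]] := step_generator k C10.
have [K2 [K20 HK2]] := generator_lip k C10.
have [K3 [K30 HK3]] := scheme_time_lip k.+2.
have [L [L0 HL]] := g_lip k.
have KL : 0 <= K2 * (K3 + L) by rewrite mulr_ge0//; lra.
exists (K1 + K2 * (K3 + L)); split; first by lra.
near=> eps => n l j s x nlT sk.
have eps0 : 0 < eps by near: eps; exact: nbhs_right_gt.
have t0 := tau_gt0 d0 nu0 eps0.
have HC : forall n j s x, n%:R * tau eps <= T -> (size s <= k.+3)%N ->
    `|U eps n j s x| <= C1 by near: eps.
have HK3' : forall n l j s x, (n + l)%:R * tau eps <= T -> (size s <= k.+2)%N ->
    `|U eps (n + l)%N j s x - U eps n j s x| <= K3 * (l%:R * tau eps) by near: eps.
have nT m : (m <= l)%N -> (n + m)%:R * tau eps <= T.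
  by move=> ml; apply: time_le nlT => //; rewrite leq_add2l.
pose P l := `|U eps (n + l)%N j s x - U eps n j s x
       - l%:R * tau eps * generator (U eps n) (g (n%:R * tau eps)) j s x|
    <= l%:R * tau eps * (K1 * eps + K2 * (K3 + L) * (l%:R * tau eps)).
suff HP m : (m <= l)%N -> P m.
  apply: le_trans (HP l (leqnn l)) _.
  have lt0 : 0 <= l%:R * tau eps by rewrite mulr_ge0// ltW.
  rewrite ler_wpM2l//.
  have := mulr_ge0 K10 lt0; have := mulr_ge0 KL (ltW eps0); lra.
rewrite /P {P}; elim: m => [|m ih] ml.
  by rewrite addn0 subrr !mul0r subr0 normr0.
have mT := nT m (ltnW ml).
have nT0 : n%:R * tau eps <= T by rewrite -[n]addn0; exact: nT.
have tm0 : 0 <= m%:R * tau eps by rewrite mulr_ge0// ltW.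
have b1 := HK1 eps (U eps (n + m)%N) (g ((n + m)%:R * tau eps)) j s x eps0
  (fun j' => is_jet_U d0 nu0 adm (n + m)%N j' eps0) (fun j' s' y => HC _ j' s' y mT) sk.
have b2 : `|generator (U eps (n + m)%N) (g ((n + m)%:R * tau eps)) j s x
   - generator (U eps n) (g (n%:R * tau eps)) j s x| <= K2 * ((K3 + L) * (m%:R * tau eps)).
  have mtau (c : R) : 0 <= c -> 0 <= c * (m%:R * tau eps) by move=> c0; rewrite mulr_ge0.
  apply: HK2 => //.
  - by move=> j' s' sk'; apply: HC => //; exact: leqW.
  - by move=> j' s' sk'; apply: HC => //; exact: leqW.
  - move=> j' s' sk'; apply: le_trans (HK3' _ _ _ _ _ mT sk') _.
    by rewrite ler_wpM2r//; lra.
  - have e1 : (n + m)%:R * tau eps - n%:R * tau eps = m%:R * tau eps.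
      by rewrite natrD; ring.
    have := HL (n%:R * tau eps) ((n + m)%:R * tau eps) j s x.
    rewrite e1 => /(_ _ _ mT sk) H; apply: le_trans (H _ _) _.
    + by rewrite mulr_ge0// ltW.
    + by rewrite -subr_ge0 e1.
    + by rewrite ler_wpM2r//; lra.
have {}ih := ih (ltnW ml).
move: b1; rewrite addnS -[step nu eps _ _]/(U eps (n + m).+1).
set c := generator (U eps (n + m)%N) _ j s x in b2 *.
set c' := generator (U eps n) _ j s x in b2 ih *.
set p := U eps (n + m).+1 j s x; set q := U eps (n + m)%N j s x in ih *.
set q' := U eps n j s x in ih * => b1.
set t := tau eps in ih b1 b2 t0 tm0 *.
have e2 : m.+1%:R * t = m%:R * t + t by rewrite -natr1; ring.
rewrite e2 (_ : p - q' - (m%:R * t + t) * c'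
  = (p - q - t * c) + t * (c - c') + (q - q' - m%:R * t * c')); last by ring.
apply: le_trans (ler_normD _ _) _; apply: le_trans (lerD (ler_normD _ _) ih) _.
rewrite normrM (gtr0_norm t0).
have b3 : t * `|c - c'| <= t * (K2 * ((K3 + L) * (m%:R * t))) by rewrite ler_wpM2l// ltW.
set D := K2 * (K3 + L) in KL *.
have b4 : t * (K2 * ((K3 + L) * (m%:R * t))) = t * (D * (m%:R * t)) by rewrite /D; ring.
have b5 : 0 <= D * t * (m%:R * t + t).
  exact: mulr_ge0 (mulr_ge0 KL (ltW t0)) (addr_ge0 tm0 (ltW t0)).
rewrite b4 in b3; move: b3 b1 b5.
set z := m%:R * t; move: `|c - c'| `|p - q - t * c| => r1 r2.
clearbody D z t; lra.
Unshelve. all: by end_near. Qed.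

End TimeIncrements.
End Generator.

(** * The limit along an ultrafilter *)

Section Ultralimit.

Lemma exists_ultrafilter : exists G : set_system nat, UltraFilter G /\ \oo `<=` G.
Proof. exact: ultraFilterLemma. Qed.

(** A single ultrafilter serves all times, components, words and points at once, and limits along it
    respect sums, products and inequalities. *)
Definition ultra : set_system nat := projT1 (cid exists_ultrafilter).

#[global] Instance ultra_UltraFilter : UltraFilter ultra.
Proof. exact: (projT2 (cid exists_ultrafilter)).1. Qed.

Lemma near_ultra (P : nat -> Prop) :
  (\forall m \near \oo, P m) -> \forall m \near ultra, P m.
Proof. exact: (projT2 (cid exists_ultrafilter)).2. Qed.

#[global] Opaque ultra.

Context {R : realType}.
Implicit Types (a b : nat -> R) (l C : R).

Definition ulim a : R := lim (a @ ultra).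

(** The image of the ultrafilter contains a compact segment, so it has a cluster point, and an
    ultrafilter converges to its cluster points. *)
Lemma ulim_cvg a C : (\forall m \near ultra, `|a m| <= C) -> a @ ultra --> ulim a.
Proof.
move=> aC; have aCC : (a @ ultra) `[- C, C]%classic.
  by apply: filterS aC => m /=; rewrite in_itv/= ler_norml.
have [p [_ clp]] := segment_compact _ aCC.
suff ap : a @ ultra --> p by exact: cvgP ap.
move=> A nA; have [//|nAc] := in_ultra_setVsetC (a @^-1` A) ultra_UltraFilter.
by have [q []] := clp (~` A) A nAc nA.
Qed.

Lemma ulimE a l : a @ ultra --> l -> ulim a = l.
Proof. by move=> al; exact: cvg_lim. Qed.

Lemma ultra_norm_le a b l l' : a @ ultra --> l -> b @ ultra --> l' ->
  (\forall m \near ultra, `|a m| <= b m) -> `|l| <= l'.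
Proof.
move=> al bl ab; apply: ler_cvg_to bl ab.
exact: cvg_norm.
Qed.

Lemma cvg_sum_seq (T : Type) (F : set_system T) {FF : Filter F} (I : Type)
    (r : seq I) (f : T -> I -> R) (L : I -> R) :
  (forall k, f z k @[z --> F] --> L k) ->
  \sum_(k <- r) f z k @[z --> F] --> \sum_(k <- r) L k.
Proof.
move=> FL; elim: r => [|k r ih].
  rewrite big_nil (_ : (fun z => _) = fun=> 0); first exact: cvg_cst.
  by apply/funext => z; rewrite big_nil.
rewrite big_cons (_ : (fun z => _) = fun z => f z k + \sum_(k <- r) f z k).
  exact: cvgD.
by apply/funext => z; rewrite big_cons.
Qed.

Definition eps_ (m : nat) : R := m.+1%:R^-1.

Lemma eps_gt0 m : 0 < eps_ m.
Proof. by rewrite invr_gt0 ltr0n. Qed.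

Lemma cvg_eps : eps_ @ ultra --> (0 : R).
Proof.
apply: cvg_trans (@cvg_harmonic R); exact: cvg_app near_ultra.
Qed.

Lemma near_eps (P : R -> Prop) :
  (\forall eps \near 0^'+, P eps) -> \forall m \near ultra, P (eps_ m).
Proof.
move=> [e /= e0 H].
have : \forall m \near ultra, `|0 - eps_ m| < e.
  by have /cvgrPdist_lt := cvg_eps; apply.
by apply: filterS => m me; apply: H => //=; exact: eps_gt0.
Qed.

End Ultralimit.

(** * Spatial derivatives and time expansion of the limit *)

Section LimitOfSchemes.
Context {R : realType} {d : nat} (nu : R) (d0 : (0 < d)%N) (nu0 : 0 < nu).
Local Notation E := 'rV[R]_d.
Local Notation e := (@unit_vec R d).
Local Notation jet := ('I_d -> seq 'I_d -> E -> R).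
Local Notation tau := (tau d nu).
Implicit Types (T C : R) (i j : 'I_d) (s : seq 'I_d) (x y : E) (t r : R).

(** For each [r] the hypothesis is an inequality between finitely many values, so it survives
    pointwise limits; differentiability of the limit is obtained through it. *)
Lemma quadratic_is_derive (f : E -> R) i x (a C : R) :
  (forall r, `|f (x + r *: e i) - f x - r * a| <= C * r ^+ 2) ->
  is_derive x (e i) f a.
Proof.
move=> H.
have C0 : 0 <= C.
  by have := H 1; rewrite expr1n mulr1; apply: le_trans.
have cv : h^-1 *: (f (h *: e i + x) - f x) @[h --> 0^'] --> a.
  apply/cvgrPdist_le => eps eps0; near=> h.
  have h0 : h != 0 by near: h; exact: nbhs_dnbhs_neq.
  rewrite (_ : a - _ = - h^-1 * (f (x + h *: e i) - f x - h * a)); last first.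
    by rewrite [_ *: (_ - _)]mulrC (addrC (h *: e i)); field.
  rewrite normrM normrN normfV mulrC ler_pdivrMr ?normr_gt0//.
  apply: le_trans (H h) _; rewrite -[h ^+ 2]ger0_norm ?sqr_ge0// normrX expr2 mulrA.
  rewrite ler_wpM2r//; apply: (@le_trans _ _ ((C + 1) * `|h|)).
    by rewrite ler_wpM2r//; lra.
  rewrite mulrC -ler_pdivlMr; last by lra.
  near: h; apply: dnbhs0_le; rewrite divr_gt0//; lra.
split; first exact: (cvgP _ cv).
exact: cvg_lim cv.
Unshelve. all: by end_near. Qed.

Context (u0 : jet) (g : R -> jet).

Definition mesh_index (m : nat) t : nat := Num.truncn (t / tau (eps_ m)).

Local Notation U m t := (scheme nu (eps_ m) u0 g (mesh_index m t)).

Definition limit_solution t : jet := fun j s x => ulim (fun m => U m t j s x).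

Let tau0 m : 0 < tau (eps_ m).
Proof. exact: tau_gt0 d0 nu0 (eps_gt0 m). Qed.

Lemma mesh_index_le m t : 0 <= t -> (mesh_index m t)%:R * tau (eps_ m) <= t.
Proof.
move=> t0; rewrite -ler_pdivlMr//.
by rewrite truncn_le divr_ge0// ltW.
Qed.

Lemma mesh_index_gt m t : 0 <= t ->
  t - tau (eps_ m) <= (mesh_index m t)%:R * tau (eps_ m).
Proof.
move=> t0; have /truncn_itv/andP[_] : 0 <= t / tau (eps_ m) by rewrite divr_ge0// ltW.
rewrite -/(mesh_index m t) ltr_pdivrMr// -natr1 mulrDl mul1r => h; lra.
Qed.

Lemma mesh_index_mono m t t' : t <= t' -> (mesh_index m t <= mesh_index m t')%N.
Proof. by move=> tt; apply: le_truncn; rewrite ler_wpM2r// invr_ge0 ltW. Qed.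

Lemma cvg_tau : tau (eps_ m) @[m --> ultra] --> (0 : R).
Proof.
have ce := @cvg_eps R.
have H : eps_ m * eps_ m * (4 * d%:R * nu)^-1 @[m --> ultra]
    --> (0 * 0 * (4 * d%:R * nu)^-1 : R).
  by apply: cvgM; [exact: cvgM|exact: cvg_cst].
rewrite !mul0r in H; apply: cvg_trans H; apply: near_eq_cvg.
by apply: nearW => m; rewrite /tau expr2.
Qed.

Lemma cvg_mesh_time t : 0 <= t -> (mesh_index m t)%:R * tau (eps_ m) @[m --> ultra] --> t.
Proof.
move=> t0; apply: (@squeeze_cvgr _ _ _ _ (fun m => t - tau (eps_ m)) (fun=> t)).
- by apply: nearW => m; rewrite mesh_index_gt// mesh_index_le.
- have H : t - tau (eps_ m) @[m --> ultra] --> t - 0.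
    by apply: cvgB; [exact: cvg_cst|exact: cvg_tau].
  by rewrite subr0 in H.
- exact: cvg_cst.
Qed.

Hypothesis adm : forall T : R, 0 <= T -> exists (M : R) (A B : nat -> R),
  [/\ forall k, 0 <= A k, forall k, 0 <= B k & admissible M A B T u0 g].
Hypothesis g_lip : forall (T : R) (k : nat), 0 <= T -> exists L : R, 0 <= L /\
  forall t t' j s x, 0 <= t -> t <= t' -> t' <= T -> (size s <= k)%N ->
    `|g t' j s x - g t j s x| <= L * (t' - t).

Lemma scheme_bound T (k : nat) : 0 <= T -> exists C, 0 <= C /\
  \forall m \near ultra, forall t j s x, 0 <= t -> t <= T -> (size s <= k)%N ->
    `|U m t j s x| <= C.
Proof.
move=> /adm[M [A [B [A0 B0 aT]]]].
have [C [C0 /near_eps HC]] := crude_bound d0 nu0 A0 B0 k aT.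
exists C; split => //; apply: filterS HC => m Hm t j s x t0 tT sk.
by apply: Hm => //; apply: le_trans tT; exact: mesh_index_le.
Qed.

Lemma limit_solution_cvg t j s x : 0 <= t ->
  U m t j s x @[m --> ultra] --> limit_solution t j s x.
Proof.
move=> t0; have [C [_ HC]] := scheme_bound (size s) t0.
by apply: (@ulim_cvg _ _ C); apply: filterS HC => m; apply.
Qed.

Lemma limit_solution_le T (k : nat) : 0 <= T -> exists C, 0 <= C /\
  forall t j s x, 0 <= t -> t <= T -> (size s <= k)%N -> `|limit_solution t j s x| <= C.
Proof.
move=> T0; have [C [C0 HC]] := scheme_bound k T0; exists C; split => // t j s x t0 tT sk.
apply: (@ultra_norm_le _ _ (fun=> C)); [exact: limit_solution_cvg|exact: cvg_cst|].
by apply: filterS HC => m; apply.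
Qed.

Lemma limit_solution_uniform (M : R) (A B : nat -> R) (k : nat) :
  0 <= M -> (forall k, 0 <= A k) -> (forall k, 0 <= B k) ->
  exists C, 0 <= C /\ forall T, admissible M A B T u0 g ->
  forall t j s x, 0 <= t -> t <= T -> (size s <= k)%N -> `|limit_solution t j s x| <= C.
Proof.
move=> M0 A0 B0; have [C [C0 HC]] := uniform_bound d0 nu0 A0 B0 k M0.
exists C; split => // T aT t j s x t0 tT sk.
apply: (@ultra_norm_le _ _ (fun=> C)); [exact: limit_solution_cvg|exact: cvg_cst|].
apply: filterS (near_eps (HC T u0 g aT)) => m Hm; apply: Hm => //.
by apply: le_trans tT; exact: mesh_index_le.
Qed.

Lemma limit_solution_jet t j : 0 <= t -> is_jet (limit_solution t j).
Proof.
move=> t0 s i x; have [M [A [B [A0 B0 aT]]]] := adm t0.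
have [C [C0 HC]] := scheme_bound (size s).+2 t0.
apply: (@quadratic_is_derive _ _ _ _ C) => r.
apply: (@ultra_norm_le _ (fun m => U m t j s (x + r *: e i) - U m t j s x - r * U m t j (i :: s) x)
  (fun=> C * r ^+ 2)); last 1 first.
- apply: filterS HC => m Hm.
  have jU := is_jet_U d0 nu0 aT (mesh_index m t) j (eps_gt0 m).
  apply: taylor2 (jU s i) (jU (i :: s) i) _ => y; exact: Hm.
- apply: cvgB; first by apply: cvgB; exact: limit_solution_cvg.
  by apply: cvgM; [exact: cvg_cst|exact: limit_solution_cvg].
- exact: cvg_cst.
Qed.

Lemma limit_solution0 j s x : limit_solution 0 j s x = u0 j s x.
Proof.
apply: ulimE; rewrite (_ : (fun m => _) = fun=> u0 j s x); first exact: cvg_cst.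
by apply/funext => m; rewrite /mesh_index mul0r truncn0.
Qed.

Lemma limit_generator_cvg t j s x : 0 <= t ->
  generator nu (U m t) (g ((mesh_index m t)%:R * tau (eps_ m))) j s x @[m --> ultra]
    --> generator nu (limit_solution t) (g t) j s x.
Proof.
move=> t0; have cU i w : U m t i w x @[m --> ultra] --> limit_solution t i w x.
  exact: limit_solution_cvg.
rewrite /generator; apply: cvgD; first apply: cvgB.
- by apply: cvgM; [exact: cvg_cst|apply: cvg_sum_seq].
- apply: cvg_sum_seq => i; apply: cvgD; first exact: cvgM.
  by apply: cvg_sum_seq => p; exact: cvgM.
(* The forcing is sampled at the mesh time below [t]; its Lipschitz bound in time closes the gap. *)
- have [L [L0 HL]] := g_lip (size s) t0.
  have c0 : L * (t - (mesh_index m t)%:R * tau (eps_ m)) @[m --> ultra] --> L * (t - t).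
    by apply: cvgM; [exact: cvg_cst|apply: cvgB; [exact: cvg_cst|exact: cvg_mesh_time]].
  rewrite subrr mulr0 in c0.
  apply/cvgrPdist_le => eps eps0; move/cvgrPdist_le : c0 => /(_ _ eps0).
  apply: filterS => m; apply: le_trans; rewrite sub0r normrN.
  apply: le_trans (ler_norm _); apply: HL => //; last exact: mesh_index_le.
  by rewrite mulr_ge0// ltW.
Qed.

Lemma limit_solution_time T (k : nat) : 0 <= T -> exists K, 0 <= K /\
  forall t t' j s x, 0 <= t -> t <= t' -> t' <= T -> (size s <= k)%N ->
  `|limit_solution t' j s x - limit_solution t j s x
     - (t' - t) * generator nu (limit_solution t) (g t) j s x| <= K * (t' - t) ^+ 2.
Proof.
move=> T0; have [M [A [B [A0 B0 aT]]]] := adm T0.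
have [K [K0 /near_eps HK]] := scheme_time_expansion d0 nu0 A0 B0 aT (fun l => g_lip l T0) k.
exists K; split => // t t' j s x t0 tt' t'T sk.
have t'0 := le_trans t0 tt'.
pose dt m := (mesh_index m t')%:R * tau (eps_ m) - (mesh_index m t)%:R * tau (eps_ m).
have cdt : dt m @[m --> ultra] --> t' - t by apply: cvgB; exact: cvg_mesh_time.
have cb : dt m * (K * (eps_ m + dt m)) @[m --> ultra] --> K * (t' - t) ^+ 2.
  rewrite (_ : K * _ = (t' - t) * (K * (0 + (t' - t)))); last by rewrite add0r; ring.
  apply: cvgM => //; apply: cvgM; first exact: cvg_cst.
  by apply: cvgD => //; exact: cvg_eps.
apply: (ultra_norm_le _ cb).
  apply: cvgB; first by apply: cvgB; exact: limit_solution_cvg.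
  by apply: cvgM; [exact: cdt|exact: limit_generator_cvg].
apply: filterS HK => m Hm.
have mm := mesh_index_mono m tt'.
have edt : dt m = (mesh_index m t' - mesh_index m t)%:R * tau (eps_ m).
  by rewrite natrB// /dt mulrBl.
have := Hm (mesh_index m t) (mesh_index m t' - mesh_index m t)%N j s x.
rewrite subnKC// -edt => H; apply: H => //.
by apply: le_trans t'T; exact: mesh_index_le.
Qed.

End LimitOfSchemes.

(** * Stability of the scheme *)

Section Stability.
Context {R : realType} {d : nat} (nu : R) (d0 : (0 < d)%N) (nu0 : 0 < nu).
Local Notation E := 'rV[R]_d.
Local Notation jet := ('I_d -> seq 'I_d -> E -> R).
Local Notation tau := (tau d nu).
Implicit Types (T C : R) (i j : 'I_d) (s : seq 'I_d) (x y : E) (t r : R).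
Context (u0 : jet) (g : R -> jet).
Local Notation U eps := (scheme nu eps u0 g).

Lemma avgB (eps : R) (f h : E -> R) x :
  avg eps (fun y => f y - h y) x = avg eps f x - avg eps h x.
Proof.
rewrite /avg -mulrBl -sumrB; congr (_ / _); apply: eq_bigr => i _; ring.
Qed.

Lemma cdiffB (eps : R) i (f h : E -> R) x :
  cdiff eps i (fun y => f y - h y) x = cdiff eps i f x - cdiff eps i h x.
Proof. by rewrite /cdiff -mulrBl; congr (_ / _); ring. Qed.

Context (T : R) (T0 : 0 <= T) (M : R) (A B : nat -> R).
Hypotheses (A0 : forall k, 0 <= A k) (B0 : forall k, 0 <= B k).
Hypothesis adm : admissible M A B T u0 g.
Context (v : R -> jet) (C K : R).
Hypotheses (v_jet : forall t j, 0 <= t -> is_jet (v t j))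
  (v_le : forall t j s x, 0 <= t -> t <= T -> (size s <= 3)%N -> `|v t j s x| <= C)
  (v_init : forall j x, v 0 j [::] x = u0 j [::] x)
  (v_time : forall t t' j x, 0 <= t -> t <= t' -> t' <= T ->
     `|v t' j [::] x - v t j [::] x
        - (t' - t) * generator nu (v t) (g t) j [::] x| <= K * (t' - t) ^+ 2).

(** The difference of the transport terms is U D(U - v) + (U - v) Dv. The first part enters the
    maximum principle for U - v, with drift U; the second is at most d C |U - v| because v has
    bounded gradient. Gronwall then sums local errors of size tau * eps. *)
Lemma scheme_converges : exists D : R, 0 <= D /\
  \forall eps \near 0^'+, forall n j x, n%:R * tau eps <= T ->
    `|U eps n j [::] x - v (n%:R * tau eps) j [::] x| <= D * eps.
Proof.
have j0 : 'I_d := Ordinal d0.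
have C0 : 0 <= C by apply: le_trans (v_le j0 (s := [::]) 0 (lexx 0) T0 isT).
have D0 : 0 < d%:R :> R by rewrite ltr0n.
have [K1 [K10 HK1]] := step_generator d0 nu0 0 C0.
have K2 : 0 <= K1 + `|K| by rewrite addr_ge0.
have dC : 0 <= d%:R * C by rewrite mulr_ge0// ltW.
(* [d * C] is the growth rate from transport; the 1 absorbs the local error [D * eps], which is
   below the running bound [Z]. *)
have [a ea] : exists a, a = d%:R * C + 1 by eexists.
have a0 : 0 <= a by lra.
have [D eD] : exists D, D = K1 + `|K| by eexists.
rewrite -eD in K2.
exists (D * expR (a * T)); split; first by rewrite mulr_ge0 ?expR_ge0.
have M0 := max_ge0 A0 B0 adm; have n0 := nu0.
near=> eps => n j x nT.
have eps0 : 0 < eps by near: eps; exact: nbhs_right_gt.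
have t0 := tau_gt0 d0 nu0 eps0.
have epsM : eps * M <= 2 * nu.
  apply: (@le_trans _ _ (eps * (M + 1))); first by rewrite ler_pM2l//; lra.
  rewrite -ler_pdivlMr; last by lra.
  by near: eps; apply: nbhs_right_le; rewrite divr_gt0//; lra.
have te : tau eps <= eps.
  apply: (tau_le d0 nu0 eps0).
  by near: eps; apply: nbhs_right_le; rewrite !mulr_gt0.
suff H : `|U eps n j [::] x - v (n%:R * tau eps) j [::] x|
    <= D * eps * (1 + tau eps * a) ^+ n.
  apply: le_trans H _; rewrite mulrAC ler_wpM2r ?(ltW eps0)// ler_wpM2l//.
  apply: (@le_trans _ _ (expR (tau eps * a) ^+ n)).
    rewrite lerXn2r// ?nnegrE ?expR_ge0// ?expR_ge1Dx//.
    by rewrite addr_ge0// mulr_ge0// ltW.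
  by rewrite -expRM_natl ler_expR mulrA mulrC ler_wpM2l.
elim: n j x nT => [|n ih] j x nT.
  rewrite mul0r v_init subrr normr0 expr0 mulr1; apply: mulr_ge0 => //; exact: ltW.
have nT' : n%:R * tau eps <= T by apply: time_le nT.
have tn0 : 0 <= n%:R * tau eps by rewrite mulr_ge0// ltW.
set Z := D * eps * _ in ih.
have {}ih k y : `|U eps n k [::] y - v (n%:R * tau eps) k [::] y| <= Z by exact: ih.
have Zeps : D * eps <= Z.
  rewrite ler_peMr ?(mulr_ge0 K2 (ltW eps0))// exprn_ege1// lerDl.
  by rewrite mulr_ge0// ltW.
pose vn := v (n%:R * tau eps); pose b := g (n%:R * tau eps).
have en : n.+1%:R * tau eps = n%:R * tau eps + tau eps by rewrite -natr1; ring.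
have b1 := HK1 eps vn b j [::] x eps0 (fun k => v_jet k tn0)
  (fun k s y hs => v_le k y tn0 nT' hs) isT.
have b2 : `|v (n.+1%:R * tau eps) j [::] x - vn j [::] x
    - tau eps * generator nu vn b j [::] x| <= `|K| * (tau eps * eps).
  have tt : n%:R * tau eps <= n.+1%:R * tau eps by rewrite en; lra.
  have := v_time j x tn0 tt nT; rewrite en (addrC (_ * _)) addrK addrC => h.
  apply: le_trans h _; apply: (@le_trans _ _ (`|K| * (tau eps) ^+ 2)).
    by rewrite ler_wpM2r ?sqr_ge0// ler_norm.
  by rewrite ler_wpM2l// expr2 ler_pM2l.
have b3 : `|step nu eps (U eps n) b j [::] x - step nu eps vn b j [::] x|
    <= Z + tau eps * (d%:R * (Z * C)).
  have -> : step nu eps (U eps n) b j [::] x - step nu eps vn b j [::] x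
    = (avg eps (fun y => U eps n j [::] y - vn j [::] y) x
       - tau eps * \sum_(i < d) U eps n i [::] x
                * cdiff eps i (fun y => U eps n j [::] y - vn j [::] y) x)
      - tau eps * \sum_(i < d) (U eps n i [::] x - vn i [::] x)
                * cdiff eps i (vn j [::]) x.
    rewrite /step avgB /transport.
    set S1 := \sum_(i < d) _; set S2 := \sum_(i < d) _.
    set S3 := \sum_(i < d) _; set S4 := \sum_(i < d) _.
    have eS : S1 - S2 = S3 + S4.
      rewrite -sumrB -big_split; apply: eq_bigr => i _.
      by rewrite /= !big_nil !addr0 cdiffB; ring.
    have -> : S1 = S2 + (S3 + S4) by rewrite -eS; ring.
    ring.
  apply: le_trans (ler_normB _ _) _; apply: lerD.
    apply: (avg_transport_le d0 nu0 eps0 x epsM) => //.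
    by move=> i; exact: (scheme_max d0 nu0 B0 adm i x eps0 epsM nT').
  rewrite normrM (gtr0_norm t0) ler_wpM2l ?(ltW t0)//.
  apply: norm_sum_ord_le => i.
  rewrite normrM; apply: ler_pM => //.
  apply: cdiff_le (v_jet j tn0 [::] i) _ => // y; exact: v_le.
rewrite -[U eps n.+1]/(step nu eps (U eps n) b).
move: b1 b2 b3; set p := step nu eps (U eps n) b j [::] x.
set q := step nu eps vn b j [::] x; set c := generator nu vn b j [::] x.
set w := v _ j [::] x; set w0 := vn j [::] x => b1 b2 b3.
rewrite (_ : p - w = (p - q) + ((q - w0 - tau eps * c) - (w - w0 - tau eps * c))); last by ring.
apply: le_trans (ler_normD _ _) _.
apply: le_trans (lerD b3 (le_trans (ler_normB _ _) (lerD b1 b2))) _.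
rewrite exprSr [leRHS]mulrA -/Z.
have h : tau eps * (D * eps) <= tau eps * Z by rewrite ler_pM2l.
by rewrite ea; rewrite eD in h; lra.
Unshelve. all: by end_near. Qed.

End Stability.

(** * Every bounded solution is the limit of the scheme *)

Section Identification.
Context {R : realType} {d : nat} (nu : R) (d0 : (0 < d)%N) (nu0 : 0 < nu).
Local Notation E := 'rV[R]_d.
Local Notation jet := ('I_d -> seq 'I_d -> E -> R).
Local Notation tau := (tau d nu).
Implicit Types (T C : R) (i j : 'I_d) (s : seq 'I_d) (x y : E) (t r : R).
Context (u0 : jet) (g : R -> jet).
Hypothesis adm : forall T : R, 0 <= T -> exists (M : R) (A B : nat -> R),
  [/\ forall k, 0 <= A k, forall k, 0 <= B k & admissible M A B T u0 g].

(** [scheme_converges] compares at the mesh time below [t]; the Lipschitz bound on [v] carries the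
    comparison to [t]. *)
Lemma limit_solution_unique (v : R -> jet) T C K t j x :
  (forall t j, 0 <= t -> is_jet (v t j)) ->
  (forall t j s x, 0 <= t -> t <= T -> (size s <= 3)%N -> `|v t j s x| <= C) ->
  (forall j x, v 0 j [::] x = u0 j [::] x) ->
  (forall t t' j x, 0 <= t -> t <= t' -> t' <= T ->
     `|v t' j [::] x - v t j [::] x
        - (t' - t) * generator nu (v t) (g t) j [::] x| <= K * (t' - t) ^+ 2) ->
  (forall t t' j x, 0 <= t -> t <= t' -> t' <= T ->
     `|v t' j [::] x - v t j [::] x| <= K * (t' - t)) ->
  0 <= t -> t <= T -> v t j [::] x = limit_solution nu u0 g t j [::] x.
Proof.
move=> vj vC v0 vK vL t0 tT; have T0 := le_trans t0 tT.
have [M [A [B [A0 B0 aT]]]] := adm T0.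
have [D [D0 /near_eps HD]] := scheme_converges d0 nu0 T0 A0 B0 aT vj vC v0 vK.
apply/esym/ulimE; apply/cvgrPdist_le => eps eps0.
pose b m := D * eps_ m + K * (t - (mesh_index (d := d) nu m t)%:R * tau (eps_ m)).
have cb : b m @[m --> ultra] --> D * 0 + K * (t - t).
  apply: cvgD; first by apply: cvgM; [exact: cvg_cst|exact: cvg_eps].
  apply: cvgM; first exact: cvg_cst.
  by apply: cvgB; [exact: cvg_cst|exact: cvg_mesh_time].
rewrite mulr0 subrr mulr0 addr0 in cb.
move/cvgrPdist_le : cb => /(_ _ eps0); apply: filterS2 HD => m Hm.
rewrite sub0r normrN => bm; apply: le_trans bm; apply: le_trans (ler_norm _).
have it := mesh_index_le d0 nu0 m t0.
have := Hm (mesh_index (d := d) nu m t) j x (le_trans it tT).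
set n := mesh_index _ _ _ in it *.
have it0 : 0 <= n%:R * tau (eps_ m) by rewrite mulr_ge0// ltW// tau_gt0// eps_gt0.
have := vL _ _ j x it0 it tT; rewrite /b -/n.
set p := v t j _ x; set q := v _ j _ x; set w := scheme _ _ _ _ _ _ _ _.
move=> h1 h2; rewrite (_ : p - w = (p - q) - (w - q)); last by ring.
by apply: le_trans (ler_normB _ _) _; lra.
Qed.

End Identification.

(** * Calculus on the half-space *)

Section TimeQuotient.
Context {R : realType}.
Implicit Types (t : R).

Definition increments t : set_system R := within [set h | 0 <= h + t] 0^'.

Lemma increments_proper t : 0 <= t -> ProperFilter (increments t).
Proof.
move=> t0; split; last by apply: within_filter.
rewrite /increments /within /= => /nbhs_ballP[eps /= eps0 H].
have e2 : 0 < eps / 2 by rewrite divr_gt0.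
apply: (H (eps / 2)); rewrite /ball/= ?gt_eqF ?addr_ge0 ?(ltW e2)//.
rewrite sub0r normrN gtr0_norm//; lra.
Qed.

Lemma increments_cvg0 t : h @[h --> increments t] --> (0 : R).
Proof. by apply: cvg_within_filter; apply: cvg_within_filter; exact: cvg_id. Qed.

Lemma near_increments t (P : R -> Prop) : (forall h, h != 0 -> 0 <= h + t -> P h) ->
  \forall h \near increments t, P h.
Proof.
move=> H; rewrite /increments near_withinE.
by apply: filterS (nbhs_dnbhs_neq (0 : R)) => h h0; exact: H.
Qed.

(** The expansion starts from the earlier of two times. For h < 0 it is therefore taken at h + t,
    and the Lipschitz bound on [psi] replaces [psi (h + t)] by [psi t]. *)
Lemma time_quotient_quadratic (phi psi : R -> R) t (T K L : R) :
  0 <= t -> t < T ->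
  (forall a b : R, 0 <= a -> a <= b -> b <= T ->
     `|phi b - phi a - (b - a) * psi a| <= K * (b - a) ^+ 2) ->
  (forall a b : R, 0 <= a -> a <= b -> b <= T -> `|psi b - psi a| <= L * (b - a)) ->
  time_quotient phi t --> psi t.
Proof.
move=> t0 tT HK HL; have FF := increments_proper t0.
apply/cvgrPdist_le => eps eps0.
have hsmall : \forall h \near increments t,
    `|h| <= T - t /\ `|h| <= eps / (`|K| + `|L| + 1).
  have /cvgrPdist_le c0 := @increments_cvg0 t.
  have p1 : 0 < T - t by lra.
  have p2 : 0 < eps / (`|K| + `|L| + 1).
    by rewrite divr_gt0// ltr_wpDl// addr_ge0.
  have := c0 _ p1; have := c0 _ p2.
  by apply: filterS2 => h; rewrite !sub0r normrN.
have hne : \forall h \near increments t, h != 0 /\ 0 <= h + t by exact: near_increments.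
near=> h.
have [h0 ht] : h != 0 /\ 0 <= h + t by near: h.
have [h1 h2] : `|h| <= T - t /\ `|h| <= eps / (`|K| + `|L| + 1) by near: h.
suff: `|phi (h + t) - phi t - h * psi t| <= (`|K| + `|L|) * `|h| * `|h|.
  move=> H; rewrite (_ : psi t - _ = - h^-1 * (phi (h + t) - phi t - h * psi t)); last first.
    by rewrite /GRing.scale/=; field.
  rewrite normrM normrN normfV mulrC ler_pdivrMr ?normr_gt0//.
  apply: le_trans H _; rewrite ler_wpM2r//.
  rewrite ler_pdivlMr in h2; last by rewrite ltr_wpDl// addr_ge0.
  by have := normr_ge0 h; lra.
have Kh (z : R) : z * h ^+ 2 <= `|z| * `|h| * `|h|.
  rewrite -mulrA -expr2 -normrX [X in _ <= _ * X]ger0_norm ?sqr_ge0//.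
  by rewrite ler_wpM2r ?sqr_ge0// ler_norm.
have HKh := Kh K; have HLh := Kh L.
have [hp|hn] := leP 0 h.
  have hT : h + t <= T by move: h1; rewrite ger0_norm//; lra.
  have := HK t (h + t) t0 _ hT; rewrite addrK lerDr => /(_ hp) H.
  apply: le_trans H _; apply: le_trans HKh _.
  by rewrite -!mulrA ler_wpM2r ?mulr_ge0// lerDl.
have hT : h + t <= t by lra.
have := HK (h + t) t ht hT (ltW tT); have := HL (h + t) t ht hT (ltW tT).
have -> : t - (h + t) = - h by ring.
rewrite sqrrN => H1 H2.
rewrite (_ : _ - _ - _ = - (phi t - phi (h + t) - - h * psi (h + t))
   - h * (psi t - psi (h + t))); last by ring.
apply: le_trans (ler_normB _ _) _; rewrite normrN normrM.
have H3 : `|h| * `|psi t - psi (h + t)| <= `|L| * `|h| * `|h|.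
  rewrite [leRHS]mulrC ler_wpM2l//; apply: le_trans H1 _.
  by apply: le_trans (ler_norm _) _; rewrite normrM normrN.
by apply: le_trans (lerD H2 H3) _; lra.
Unshelve. all: by end_near. Qed.

Lemma time_quotient_continuous (phi : R -> R) t (l : R) : 0 <= t ->
  time_quotient phi t --> l -> phi (h + t) @[h --> increments t] --> phi t.
Proof.
move=> t0 H; have FF := increments_proper t0.
have H1 : h * (h^-1 * (phi (h + t) - phi t)) + phi t @[h --> increments t] --> 0 * l + phi t.
  apply: cvgD; last exact: cvg_cst.
  by apply: cvgM; [exact: increments_cvg0|exact: H].
rewrite mul0r add0r in H1; apply: cvg_trans H1; apply: near_eq_cvg.
by apply: near_increments => h h0 _; rewrite mulrA divff// mul1r subrK.
Qed.

Lemma time_quotientD (phi psi : R -> R) t (a b : R) : 0 <= t ->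
  time_quotient phi t --> a -> time_quotient psi t --> b ->
  time_quotient (fun r => phi r + psi r) t --> a + b.
Proof.
move=> t0 H1 H2; have FF := increments_proper t0.
have H : h^-1 *: (phi (h + t) - phi t) + h^-1 *: (psi (h + t) - psi t)
   @[h --> increments t] --> a + b by exact: cvgD.
apply: cvg_trans H; apply: near_eq_cvg; apply: nearW => h /=.
by rewrite -scalerDr; congr (_ *: _); ring.
Qed.

Lemma time_quotientM (phi psi : R -> R) t (a b : R) : 0 <= t ->
  time_quotient phi t --> a -> time_quotient psi t --> b ->
  time_quotient (fun r => phi r * psi r) t --> a * psi t + phi t * b.
Proof.
move=> t0 H1 H2; have FF := increments_proper t0.
have H3 := time_quotient_continuous t0 H2.
have H : (h^-1 *: (phi (h + t) - phi t)) * psi (h + t)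
   + phi t * (h^-1 *: (psi (h + t) - psi t)) @[h --> increments t]
   --> a * psi t + phi t * b.
  by apply: cvgD; [exact: cvgM|apply: cvgM => //; exact: cvg_cst].
apply: cvg_trans H; apply: near_eq_cvg; apply: nearW => h /=.
by rewrite /GRing.scale/=; ring.
Qed.

Lemma time_quotient_cst (c : R) t : 0 <= t -> time_quotient (fun=> c) t --> (0 : R).
Proof.
move=> t0; have FF := increments_proper t0.
have H : (0 : R) @[h --> increments t] --> (0 : R) by exact: cvg_cst.
apply: cvg_trans H; apply: near_eq_cvg; apply: nearW => h /=.
by rewrite subrr scaler0.
Qed.

Lemma time_quotient_ext {V : normedModType R} (phi psi : R -> V) t (l : V) : 0 <= t ->
  (forall r, 0 <= r -> phi r = psi r) ->
  time_quotient phi t --> l -> time_quotient psi t --> l.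
Proof.
move=> t0 H; have FF := increments_proper t0; apply: cvg_trans.
apply: (@near_eq_cvg _ _ (increments t)); by apply: near_increments => h h0 ht; rewrite !H.
Qed.

End TimeQuotient.

Section Coordinates.
Context {R : realType} {d : nat}.
Local Notation E := 'rV[R]_d.
Local Notation e := (@unit_vec R d).
Implicit Types (i j : 'I_d) (s : seq 'I_d) (x y : E) (t : R).

Lemma cvg_row (T : Type) (F : set_system T) {FF : Filter F} (f : T -> E) (l : E) :
  (forall j, f z 0 j @[z --> F] --> l 0 j) -> f @ F --> l.
Proof.
move=> H; apply/cvgrPdist_le => /= eps eps0; near=> z.
rewrite /Num.Def.normr/= mx_normrE (bigmax_le _ (ltW eps0))//= => -[i j] _.
rewrite !mxE/= [i]ord1; move: j {i}; near: z; apply: filter_forall => /= j.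
by have /cvgrPdist_le := H j; apply.
Unshelve. all: by end_near. Qed.

Lemma cvg_coord (T : Type) (F : set_system T) {FF : Filter F} (f : T -> E) (l : E) j :
  f @ F --> l -> f z 0 j @[z --> F] --> l 0 j.
Proof.
move=> H; apply: (cvg_comp f (fun M : E => M 0 j) H).
exact: coord_continuous.
Qed.

(** Existence and value of a derivative in one scalar relation, so that sum and product rules
    compose. *)
Definition coord_deriv_to (a : option 'I_d) (f : R -> E -> R) t x (l : R) : Prop :=
  if a is Some i then is_derive x (e i) (f t) l else time_quotient (f^~ x) t --> l.

Lemma coord_deriv_to_component a (F : R -> E -> E) t x j : 0 <= t ->
  coord_derivable a F t x ->
  coord_deriv_to a (fun r y => F r y 0 j) t x (coord_derive a F t x 0 j).
Proof.
move=> t0; case: a => [i|] /= H.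
  have Hj := (derivable_mxP (F t) x (e i)).1 H 0 j.
  by split => //; rewrite derive_mx// mxE.
have FF := increments_proper t0.
have Hc : (h^-1 *: (F (h + t) x - F t x)) 0 j @[h --> increments t]
    --> time_derive (F^~ x) t 0 j by exact: cvg_coord.
by apply: cvg_trans Hc; apply: (@near_eq_cvg _ _ (increments t)); apply: nearW => h; rewrite !mxE.
Qed.

Lemma coord_derive_row a (F : R -> E -> E) t x (l : E) : 0 <= t ->
  (forall j, coord_deriv_to a (fun r y => F r y 0 j) t x (l 0 j)) ->
  coord_derivable a F t x /\ coord_derive a F t x = l.
Proof.
move=> t0; case: a => [i|] /= H.
  have D : derivable (F t) x (e i).
    by apply/derivable_mxP => k j; rewrite [k]ord1; have [] := H j.
  split => //; rewrite derive_mx//; apply/rowP => j; rewrite mxE.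
  by have [] := H j.
have FF := increments_proper t0.
have Hc : time_quotient (F^~ x) t --> l.
  apply: (@cvg_row _ (increments t)) => j; apply: cvg_trans (H j).
  by apply: (@near_eq_cvg _ _ (increments t)); apply: nearW => h; rewrite !mxE.
by split; [exact: cvgP Hc|exact: cvg_lim Hc].
Qed.

Lemma coord_deriv_to_ext a (f f' : R -> E -> R) t x (l : R) : 0 <= t ->
  (forall r y, 0 <= r -> f r y = f' r y) ->
  coord_deriv_to a f t x l -> coord_deriv_to a f' t x l.
Proof.
move=> t0 ff'; case: a => [i|] /=; last first.
  by apply: time_quotient_ext => // r r0; exact: ff'.
by rewrite (_ : f t = f' t)//; apply/funext => y; exact: ff'.
Qed.

Definition continuous_on_halfspace (f : R -> E -> R) : Prop := forall t x, 0 <= t ->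
  f z.1 z.2 @[z --> within [set z : R * E | 0 <= z.1] (nbhs (t, x))] --> f t x.

(** By induction on the word, each iterated derivative agrees at nonnegative times with a field
    whose components lie in [P]; at such times [coord_derive] sees only nonnegative times. *)
Lemma smooth_of_stable_family (P : (R -> E -> R) -> Prop) (F : R -> E -> E) :
  (forall f, P f -> continuous_on_halfspace f /\
     forall a, exists f', P f' /\
       forall t x, 0 <= t -> coord_deriv_to a f t x (f' t x)) ->
  (forall j, P (fun t x => F t x 0 j)) -> smooth_on_halfspace F.
Proof.
move=> HP PF.
have step a (G : R -> E -> E) : (forall j, P (fun t x => G t x 0 j)) ->
    exists G' : R -> E -> E, (forall j, P (fun t x => G' t x 0 j)) /\
      forall t x j, 0 <= t -> coord_deriv_to a (fun r y => G r y 0 j) t x (G' t x 0 j).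
  move=> PG; have /choice [f' Hf'] j := (HP _ (PG j)).2 a.
  exists (fun t x => \row_j f' j t x); split => [j|t x j t0].
    rewrite (_ : (fun t x => _) = f' j); first exact: (Hf' j).1.
    by apply/funext => t; apply/funext => x; rewrite mxE.
  by rewrite mxE; exact: (Hf' j).2.
have H w : exists F' : R -> E -> E, (forall j, P (fun t x => F' t x 0 j)) /\
    forall t x, 0 <= t -> foldr coord_derive F w t x = F' t x.
  elim: w => [|a w [F' [PF' eF']]]; first by exists F.
  have [G' [PG' dG']] := step a F' PF'; exists G'; split => // t x t0.
  apply: (coord_derive_row (F := foldr coord_derive F w) t0 _).2 => j.
  apply: coord_deriv_to_ext t0 _ (dG' t x j t0) => r y r0.
  by rewrite eF'.
move=> w; have [F' [PF' eF']] := H w; split => [a t x t0|].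
  have [G' [_ dG']] := step a F' PF'.
  apply: (coord_derive_row (l := G' t x) t0 _).1 => j.
  apply: coord_deriv_to_ext t0 _ (dG' t x j t0) => r y r0.
  by rewrite eF'.
apply/subspace_continuousP => -[t x] /= t0.
apply: cvg_row => j; rewrite /from_subspace /= (eF' _ _ t0).
apply: cvg_trans ((HP _ (PF' j)).1 t x t0); apply: near_eq_cvg.
by rewrite near_withinE; apply: nearW => z z0 /=; rewrite eF'.
Qed.

End Coordinates.

(** * Time derivative and joint continuity of the limit *)

Section LimitTimeDerivative.
Context {R : realType} {d : nat} (nu : R) (d0 : (0 < d)%N) (nu0 : 0 < nu).
Local Notation E := 'rV[R]_d.
Local Notation jet := ('I_d -> seq 'I_d -> E -> R).
Implicit Types (T C : R) (i j : 'I_d) (s : seq 'I_d) (x y : E) (t r : R).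
Context (u0 : jet) (g : R -> jet).
Hypothesis adm : forall T : R, 0 <= T -> exists (M : R) (A B : nat -> R),
  [/\ forall k, 0 <= A k, forall k, 0 <= B k & admissible M A B T u0 g].
Hypothesis g_lip : forall (T : R) (k : nat), 0 <= T -> exists L : R, 0 <= L /\
  forall t t' j s x, 0 <= t -> t <= t' -> t' <= T -> (size s <= k)%N ->
    `|g t' j s x - g t j s x| <= L * (t' - t).
Local Notation V := (limit_solution nu u0 g).

Lemma limit_solution_lip T (k : nat) : 0 <= T -> exists K, 0 <= K /\
  forall t t' j s x, 0 <= t -> t <= t' -> t' <= T -> (size s <= k)%N ->
    `|V t' j s x - V t j s x| <= K * (t' - t).
Proof.
move=> T0; have [M [A [B [A0 B0 aT]]]] := adm T0.
have [K [K0 HK]] := limit_solution_time d0 nu0 adm g_lip k T0.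
have [C [C0 HC]] := limit_solution_le d0 nu0 adm k.+2 T0.
have [C' [C'0 HC']] := forcing_bound B0 aT k.
have CC : 0 <= C + C' by lra.
have [D [D0 HD]] := generator_le d0 nu0 k CC.
exists (K * T + D); split; first by rewrite addr_ge0// mulr_ge0.
move=> t t' j s x t0 tt' t'T sk.
have H1 := HK t t' j s x t0 tt' t'T sk; have tT := le_trans tt' t'T.
have H2 : `|generator nu (V t) (g t) j s x| <= D.
  apply: HD => //.
    by move=> j' s' sk'; apply: le_trans (HC _ _ _ _ t0 tT sk') _; lra.
  by apply: le_trans (HC' _ _ _ _ t0 tT sk) _; lra.
move: H1 H2; set c := generator _ _ _ _ _ _; set p := V _ _ _ _; set q := V _ _ _ _ => H1 H2.
rewrite (_ : p - q = (p - q - (t' - t) * c) + (t' - t) * c); last by ring.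
have dt0 : 0 <= t' - t by lra.
apply: le_trans (ler_normD _ _) _; rewrite (mulrDl _ _ (t' - t)); apply: lerD.
  apply: le_trans H1 _; rewrite expr2 mulrA ler_wpM2r// ler_wpM2l//; lra.
by rewrite normrM (ger0_norm dt0) mulrC ler_wpM2r.
Qed.

Lemma limit_solution_time_quotient t j s x : 0 <= t ->
  time_quotient (fun r => V r j s x) t --> generator nu (V t) (g t) j s x.
Proof.
move=> t0; have T0 : 0 <= t + 1 by lra.
pose k := size s.
have [K [K0 HK]] := limit_solution_time d0 nu0 adm g_lip k T0.
have [L [L0 HL]] := limit_solution_lip k.+2 T0.
have [L' [L'0 HL']] := g_lip k T0.
have [C [C0 HC]] := limit_solution_le d0 nu0 adm k.+2 T0.
have [D [D0 HD]] := generator_lip d0 nu0 k C0.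
apply: (@time_quotient_quadratic _ _ (fun r => generator nu (V r) (g r) j s x) _
  (t + 1) K (D * (L + L'))) => //; first by lra.
  by move=> a b a0 ab bT; apply: HK.
move=> a b a0 ab bT; rewrite -mulrA; have b0 := le_trans a0 ab.
have ab0 : 0 <= b - a by lra.
have aT := le_trans ab bT.
apply: HD => //.
- by move=> j' s' sk'; apply: HC.
- by move=> j' s' sk'; apply: HC.
- move=> j' s' sk'; apply: le_trans (HL _ _ _ _ _ a0 ab bT sk') _.
  by rewrite ler_wpM2r//; lra.
- apply: le_trans (HL' _ _ _ _ _ a0 ab bT (leqnn _)) _.
  by rewrite ler_wpM2r//; lra.
Qed.

(** Near (t, x) there are Lipschitz bounds in time and in each coordinate, uniform in the other
    variables up to time t + 1. *)
Lemma limit_solution_continuous j s : continuous_on_halfspace (fun t x => V t j s x).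
Proof.
move=> t x t0; have T0 : 0 <= t + 1 by lra.
have [L [L0 HL]] := limit_solution_lip (size s) T0.
have [C [C0 HC]] := limit_solution_le d0 nu0 adm (size s).+1 T0.
pose F := within [set z : R * E | 0 <= z.1] (nbhs (t, x)).
have FF : Filter F by exact: within_filter.
pose b (z : R * E) := L * `|z.1 - t| + C * \sum_(i < d) `|x 0 i - z.2 0 i|.
have cb : b z @[z --> F] --> b (t, x).
  apply: cvg_within_filter.
  have c1 : z.1 @[z --> nbhs ((t, x) : R * E)] --> t by exact: cvg_fst.
  have c2 : z.2 @[z --> nbhs ((t, x) : R * E)] --> x by exact: cvg_snd.
  apply: cvgD; apply: cvgM; try exact: cvg_cst.
    by apply: cvg_norm; apply: cvgB => //; exact: cvg_cst.
  apply: cvg_sum_seq => i; apply: cvg_norm; apply: cvgB; first exact: cvg_cst.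
  exact: cvg_coord c2.
have b0 : b (t, x) = 0.
  rewrite /b/= subrr normr0 mulr0 add0r big1 ?mulr0// => i _.
  by rewrite subrr normr0.
rewrite b0 in cb.
have c1 : z.1 @[z --> F] --> t by apply: cvg_within_filter; exact: cvg_fst.
apply/cvgrPdist_le => eps eps0.
have /cvgrPdist_le /(_ _ eps0) cbe := cb.
have /cvgrPdist_le /(_ _ ltr01) c1e := c1.
have z0 : \forall z \near F, 0 <= z.1.
  by rewrite /F near_withinE; exact: nearW.
apply: filterS3 cbe c1e z0 => -[r y] /= h1 h2 r0.
rewrite sub0r normrN in h1; apply: le_trans h1; apply: le_trans (ler_norm _).
have rT : r <= t + 1 by move: h2; rewrite ler_distl; lra.
rewrite (_ : V t j s x - _ = (V t j s x - V r j s x) + (V r j s x - V r j s y)); last by ring.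
apply: le_trans (ler_normD _ _) _; rewrite /b/=; apply: lerD.
  have [tr|rt] := leP t r.
    by rewrite distrC (ger0_norm (_ : 0 <= r - t)) ?subr_ge0//; exact: (HL t r).
  rewrite (ltr0_norm (_ : r - t < 0)) ?subr_lt0// opprB.
  by apply: (HL r t) => //; [exact: ltW|lra].
apply: lipschitz_coordinates => i z p.
by apply: taylor1 (limit_solution_jet d0 nu0 adm j r0 s i) _ => w; apply: HC.
Qed.

End LimitTimeDerivative.

(** * A family of functions closed under differentiation *)

Section PolynomialFamily.
Context {R : realType} {d : nat}.
Local Notation E := 'rV[R]_d.
Local Notation jet := ('I_d -> seq 'I_d -> E -> R).
Implicit Types (i j : 'I_d) (s : seq 'I_d) (x y : E) (t r : R).
Context (nu : R) (V : R -> jet) (G : seq (option 'I_d) -> 'I_d -> R -> E -> R).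

(* Polynomials in the spatial derivatives V of the solution and in those
   derivatives G w of the forcing whose word w satisfies W. *)
Inductive poly_family (W : seq (option 'I_d) -> Prop) : (R -> E -> R) -> Prop :=
| poly_sol j s : poly_family W (fun t x => V t j s x)
| poly_forcing j w : W w -> poly_family W (G w j)
| poly_cst (c : R) : poly_family W (fun _ _ => c)
| poly_add f h : poly_family W f -> poly_family W h ->
    poly_family W (fun t x => f t x + h t x)
| poly_mul f h : poly_family W f -> poly_family W h ->
    poly_family W (fun t x => f t x * h t x).

Context (W : seq (option 'I_d) -> Prop).
Local Notation P := (poly_family W).
Local Notation forcing t := (fun j s x => G (map some s) j t x).

Lemma poly_sum (I : Type) (r : seq I) (F : I -> R -> E -> R) :
  (forall k, P (F k)) -> P (fun t x => \sum_(k <- r) F k t x).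
Proof.
move=> PF; elim: r => [|k r ih].
  rewrite (_ : (fun t x => _) = fun _ _ => 0); first exact: poly_cst.
  by apply/funext => t; apply/funext => x; rewrite big_nil.
rewrite (_ : (fun t x => _) = fun t x => F k t x + \sum_(k <- r) F k t x).
  exact: poly_add.
by apply/funext => t; apply/funext => x; rewrite big_cons.
Qed.

Lemma poly_generator j s : (forall s, W (map some s)) ->
  P (fun t x => generator nu (V t) (forcing t) j s x).
Proof.
move=> Ws; rewrite /generator; apply: poly_add; last exact: poly_forcing.
rewrite (_ : (fun t x => _) = fun t x => nu * (\sum_(i < d) V t j (i :: i :: s) x)
  + (-1) * \sum_(i < d) (V t i [::] x * V t j (i :: s) x
    + \sum_(p <- proper_splits s) V t i p.1 x * V t j (i :: p.2) x)); last first.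
  by apply/funext => t; apply/funext => x; rewrite mulN1r.
apply: poly_add; apply: poly_mul; try exact: poly_cst; apply: poly_sum => i.
  exact: poly_sol.
apply: poly_add; first by apply: poly_mul; exact: poly_sol.
by apply: poly_sum => p; apply: poly_mul; exact: poly_sol.
Qed.

Hypotheses (V_jet : forall t j, 0 <= t -> is_jet (V t j))
  (V_time : forall t j s x, 0 <= t ->
     time_quotient (fun r => V r j s x) t --> generator nu (V t) (forcing t) j s x)
  (G_deriv : forall a w j t x, 0 <= t -> W w ->
     coord_deriv_to a (G w j) t x (G (a :: w) j t x)).

(** The equation enters here: it turns the time derivative of a spatial derivative of the solution
    into the generator, again a polynomial. Closure of [W] is asked for the letter [a] alone, so the
    lemma applies to arbitrary words and also to words closed under time derivatives only. *)
Lemma poly_derivative a f : (forall s, W (map some s)) ->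
  (forall w, W w -> W (a :: w)) -> P f ->
  exists f', P f' /\ forall t x, 0 <= t -> coord_deriv_to a f t x (f' t x).
Proof.
move=> Ws Wa; elim=> {f} [j s|j w Ww|c|f h Pf [f' [Pf' df]] Ph [h' [Ph' dh]]
  |f h Pf [f' [Pf' df]] Ph [h' [Ph' dh]]].
- case: a {Wa} => [i|].
    exists (fun t x => V t j (i :: s) x); split; first exact: poly_sol.
    by move=> t x t0; exact: V_jet.
  exists (fun t x => generator nu (V t) (forcing t) j s x); split.
    exact: poly_generator.
  by move=> t x t0; exact: V_time.
- exists (G (a :: w) j); split; first by apply: poly_forcing; exact: Wa.
  by move=> t x t0; exact: G_deriv.
- exists (fun _ _ => 0); split; first exact: poly_cst.
  move=> t x t0; case: a {Wa} => [i|] /=; first exact: is_derive_cst_fun.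
  exact: time_quotient_cst.
- exists (fun t x => f' t x + h' t x); split; first exact: poly_add.
  move=> t x t0; move: (df t x t0) (dh t x t0); case: a {Wa df dh} => [i|] /=.
    exact: is_deriveD_fun.
  exact: time_quotientD.
- exists (fun t x => f' t x * h t x + f t x * h' t x); split.
    by apply: poly_add; exact: poly_mul.
  move=> t x t0; move: (df t x t0) (dh t x t0); case: a {Wa df dh} => [i|] /=.
    exact: is_deriveM_fun.
  exact: (@time_quotientM _ (f^~ x) (h^~ x)).
Qed.

Lemma poly_continuous f :
  (forall j s, continuous_on_halfspace (fun t x => V t j s x)) ->
  (forall w j, W w -> continuous_on_halfspace (G w j)) ->
  P f -> continuous_on_halfspace f.
Proof.
move=> cV cG; elim=> {f} [j s|j w Ww|c|f h _ cf _ ch|f h _ cf _ ch] //.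
- exact: cG.
- by move=> t x t0; exact: cvg_cst.
- by move=> t x t0; apply: cvgD; [exact: cf|exact: ch].
- by move=> t x t0; apply: cvgM; [exact: cf|exact: ch].
Qed.

(** [I] is a set of times: [0, T] for the local bounds, the whole half-line for the bounds without
    horizon. *)
Lemma poly_bounded (I : R -> Prop) f :
  (forall j s, exists C : R, forall t x, I t -> `|V t j s x| <= C) ->
  (forall w j, W w -> exists C : R, forall t x, I t -> `|G w j t x| <= C) ->
  P f -> exists C : R, forall t x, I t -> `|f t x| <= C.
Proof.
move=> bV bG; elim=> {f} [j s|j w Ww|c|f h _ [C cf] _ [D ch]|f h _ [C cf] _ [D ch]] //.
- exact: bG.
- by exists `|c|.
- exists (C + D) => t x It; apply: le_trans (ler_normD _ _) _.
  by apply: lerD; [exact: cf|exact: ch].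
- exists (C * D) => t x It; rewrite normrM; apply: ler_pM => //; [exact: cf|exact: ch].
Qed.

End PolynomialFamily.

(** * Iterated derivatives of smooth fields, indexed by words *)

Section Words.
Context {R : realType} {d : nat}.
Local Notation E := 'rV[R]_d.
Local Notation e := (@unit_vec R d).
Local Notation jet := ('I_d -> seq 'I_d -> E -> R).
Implicit Types (i j : 'I_d) (s : seq 'I_d) (w : seq (option 'I_d)) (x y : E) (t r : R).
Implicit Types (f g : R -> E -> E).

Definition word_derive f w j t x : R := foldr coord_derive f w t x 0 j.

Definition field_jet f t : jet := fun j s x => word_derive f (map some s) j t x.

Lemma partial_derive_word f s t x :
  foldr coord_derive f (map some s) t x = partial_derive s (f t) x.
Proof.
elim: s x => [//|i s ih] x /=; rewrite /coord_derive.
by congr ('D_(unit_vec i) _ x); apply/funext => y; exact: ih.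
Qed.

Lemma word_derive_deriv f w a j t x : smooth_on_halfspace f -> 0 <= t ->
  coord_deriv_to a (word_derive f w j) t x (word_derive f (a :: w) j t x).
Proof.
by move=> sf t0; apply: coord_deriv_to_component => //; exact: (sf w).1.
Qed.

Lemma field_jet_jet f t j : smooth_on_halfspace f -> 0 <= t -> is_jet (field_jet f t j).
Proof. by move=> sf t0 s i x; exact: (word_derive_deriv (map some s) (Some i)). Qed.

Lemma smooth_jet (h : E -> E) j : smooth h ->
  is_jet (fun s x => partial_derive s h x 0 j).
Proof.
move=> sh s i x; have H := (sh s).1 i x.
have Hj := (derivable_mxP (partial_derive s h) x (e i)).1 H 0 j.
by split => //; rewrite /= derive_mx// mxE.
Qed.

Lemma word_derive_continuous f w j : smooth_on_halfspace f ->
  continuous_on_halfspace (word_derive f w j).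
Proof.
move=> sf t x t0; have /subspace_continuousP /(_ (t, x) t0) H := (sf w).2.
exact: (@cvg_coord _ _ _ _ _ _ _ j H).
Qed.

Lemma word_derive_is_derive f w j t x : smooth_on_halfspace f -> 0 < t ->
  is_derive t 1 (fun r => word_derive f w j r x) (word_derive f (None :: w) j t x).
Proof.
move=> sf t0; have /= H := (sf w).1 None t x (ltW t0).
rewrite time_derivable_gt0// in H.
have Hj := (derivable_mxP _ _ _).1 H 0 j.
by split => //; rewrite /word_derive /= time_derive_gt0// derive_mx// mxE.
Qed.

Lemma word_derive_time_continuous f w j x (a b : R) : smooth_on_halfspace f -> 0 <= a ->
  {within `[a, b], continuous (fun r => word_derive f w j r x)}.
Proof.
move=> sf a0; apply/subspace_continuousP => t /=; rewrite in_itv/= => /andP[ta tb].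
have t0 := le_trans a0 ta.
have H := @word_derive_continuous f w j sf t x t0.
have c : (r, x) @[r --> nbhs t] --> ((t, x) : R * E).
  have c1 : r @[r --> nbhs t] --> t by exact: cvg_id.
  have c2 : x @[_ --> nbhs t] --> x by exact: cvg_cst.
  exact: (@cvg_pair R R E (nbhs t) (nbhs t) (nbhs x) _ _ _ _ _ c1 c2).
move=> B /H /c HB.
have {}HB : \forall r \near t, 0 <= r -> B (word_derive f w j r x) := HB.
change (\forall r \near within `[a, b]%classic (nbhs t), B (word_derive f w j r x)).
rewrite near_withinE; apply: filterS HB => r HB /=.
by rewrite in_itv/= => /andP[ar _]; apply: HB; exact: le_trans ar.
Qed.

Lemma word_derive_lip f w j x (a b C : R) : smooth_on_halfspace f -> 0 <= a -> a <= b ->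
  (forall t, a <= t <= b -> `|word_derive f (None :: w) j t x| <= C) ->
  `|word_derive f w j b x - word_derive f w j a x| <= C * (b - a).
Proof.
move=> sf a0 ab H.
apply: (mvt_le (phi := fun r => word_derive f w j r x)
   (phi' := fun r => word_derive f (None :: w) j r x)) => //.
  by move=> r /andP[ar _]; apply: word_derive_is_derive => //; exact: le_lt_trans ar.
exact: word_derive_time_continuous.
Qed.

(** Mean value inequality after subtracting [c * r], with [c] the time derivative at [a]: by
    [word_derive_lip] the derivative of the difference is at most C (b - a). *)
Lemma word_derive_expansion f w j x (a b C : R) : smooth_on_halfspace f ->
  0 <= a -> a <= b ->
  (forall t, a <= t <= b -> `|word_derive f [:: None, None & w] j t x| <= C) ->
  `|word_derive f w j b x - word_derive f w j a x
     - (b - a) * word_derive f (None :: w) j a x| <= C * (b - a) ^+ 2.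
Proof.
move=> sf a0 ab H; set c := word_derive f (None :: w) j a x.
have C0 : 0 <= C by apply: le_trans (H a _); rewrite ?lexx.
have := @mvt_le R (fun r => word_derive f w j r x - c * r)
   (fun r => word_derive f (None :: w) j r x - c) a b (C * (b - a)) ab.
rewrite (_ : C * (b - a) * (b - a) = C * (b - a) ^+ 2); last by ring.
rewrite (_ : word_derive f w j b x - c * b - (word_derive f w j a x - c * a)
  = word_derive f w j b x - word_derive f w j a x - (b - a) * c); last by ring.
apply.
- move=> r /andP[ar _]; apply: is_deriveB_fun.
    by apply: word_derive_is_derive => //; exact: le_lt_trans ar.
  apply: is_derive_val (is_deriveMl_fun c (is_derive_id r 1)) _.
  by rewrite mulr1.
- have cw := @word_derive_time_continuous f w j x a b sf a0.
  apply/subspace_continuousP => r rab.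
  have /subspace_continuousP /(_ r rab) H1 := cw.
  have FF : Filter (within `[a, b]%classic (nbhs r)) by exact: within_filter.
  apply: cvgB; first exact: H1.
  by apply: cvgM; [exact: cvg_cst|apply: cvg_within_filter; exact: cvg_id].
- move=> r /andP[ar rb].
  apply: (@le_trans _ _ (C * (r - a))).
    apply: word_derive_lip => // t /andP[at1 tr].
    by apply: H; rewrite at1 (le_trans tr).
  by rewrite ler_wpM2l// lerD2r.
Qed.

Lemma dt_nabla_word (mu k : nat) f t x (s : k.-tuple 'I_d) :
  dt_nabla mu k f t x s = foldr coord_derive f (nseq mu None ++ map some s) t x.
Proof.
rewrite ffunE (_ : (fun r => _) = fun r => foldr coord_derive f (map some s) r x).
  by elim: mu t => [//|mu ih] t /=; rewrite /coord_derive; congr time_derive; exact/funext.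
by apply/funext => r; rewrite ffunE partial_derive_word.
Qed.

Lemma sup_norm_component (k : nat) (F : E -> tensor k) (C : R) x (s : k.-tuple 'I_d) j :
  (sup_norm F < C%:E)%E -> `|F x s 0 j| <= C.
Proof.
move=> FC; have FxC : tensor_norm (F x) <= C.
  rewrite -lee_fin; apply: ltW; apply: le_lt_trans FC.
  by apply: ereal_sup_ubound; exists x.
apply: le_trans FxC; rewrite -sqrtr_sqr /tensor_norm ler_wsqrtr//.
rewrite (bigD1 s)//= (bigD1 j)//= -addrA lerDl addr_ge0//.
  by apply: sumr_ge0 => i _; exact: sqr_ge0.
by apply: sumr_ge0 => i _; apply: sumr_ge0 => l _; exact: sqr_ge0.
Qed.

Lemma sup_norm_lt (I : R -> Prop) (k : nat) (F : R -> E -> tensor k) :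
  (forall (s : k.-tuple 'I_d) j, exists C : R, forall t x, I t -> `|F t x s 0 j| <= C) ->
  exists C : R, forall t, I t -> (sup_norm (F t) < C%:E)%E.
Proof.
move=> H.
have /choice [c Hc] (p : k.-tuple 'I_d * 'I_d) :
    exists C : R, forall t x, I t -> `|F t x p.1 0 p.2| <= C by exact: H.
exists (Num.sqrt (\sum_(s : k.-tuple 'I_d) \sum_(j < d) c (s, j) ^+ 2) + 1) => t It.
apply: (@le_lt_trans _ _ (Num.sqrt (\sum_(s : k.-tuple 'I_d) \sum_(j < d) c (s, j) ^+ 2))%:E).
  apply: ge_ereal_sup => _ [x _ <-]; rewrite lee_fin ler_wsqrtr//.
  apply: ler_sum => s _; apply: ler_sum => j _.
  have cb := Hc (s, j) t x It; rewrite -[leLHS]ger0_norm ?sqr_ge0// normrX.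
  by rewrite lerXn2r// nnegrE//; exact: le_trans cb.
by rewrite lte_fin ltrDl.
Qed.

Lemma word_bound f (mu k : nat) (T : R) : bounded_derivatives f -> 0 <= T ->
  exists C : R, 0 <= C /\ forall t s j x, 0 <= t -> t <= T -> (size s <= k)%N ->
    `|word_derive f (nseq mu None ++ map some s) j t x| <= C.
Proof.
move=> bf T0.
have /choice [c Hc] (l : nat) : exists C : R, forall t s j x, 0 <= t -> t <= T ->
    size s = l -> `|word_derive f (nseq mu None ++ map some s) j t x| <= C.
  (* [bounded_derivatives] concerns positive horizons; passing to T + 1 includes T = 0. *)
  have T1 : 0 < T + 1 by lra.
  have [C HC] := bf mu l (T + 1) T1; exists C => t s j x t0 tT /eqP sl.
  have tT1 : t <= T + 1 by lra.
  have := sup_norm_component x (Tuple sl) j (HC t t0 tT1).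
  by rewrite dt_nabla_word.
exists (\sum_(l < k.+1) `|c l|); split; first by apply: sumr_ge0.
move=> t s j x t0 tT sk; apply: le_trans (Hc _ t s j x t0 tT erefl) _.
have sk' : (size s < k.+1)%N by [].
apply: le_trans (ler_norm _) _.
by rewrite (bigD1 (Ordinal sk'))//= lerDl sumr_ge0.
Qed.

Lemma burgers_component (nu : R) f g t x :
  time_derive (f^~ x) t - nu *: laplacian (f t) x + advection (f t) (f t) x = g t x
  <-> forall j, word_derive f [:: None] j t x
       = generator nu (field_jet f t) (field_jet g t) j [::] x.
Proof.
have eqj j : (time_derive (f^~ x) t - nu *: laplacian (f t) x
    + advection (f t) (f t) x) 0 j = word_derive f [:: None] j t x
  - nu * (\sum_(i < d) field_jet f t j [:: i; i] x)
  + \sum_(i < d) field_jet f t i [::] x * field_jet f t j [:: i] x.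
  rewrite !mxE /laplacian /advection !summxE; congr (_ - _ * _ + _).
  by apply: eq_bigr => i _; rewrite !mxE.
have eqg j : generator nu (field_jet f t) (field_jet g t) j [::] x =
    nu * (\sum_(i < d) field_jet f t j [:: i; i] x)
    - \sum_(i < d) field_jet f t i [::] x * field_jet f t j [:: i] x + g t x 0 j.
  rewrite /generator; congr (_ - _ + _).
  by apply: eq_bigr => i _; rewrite big_nil addr0.
split=> [H j|H].
  by rewrite eqg -H eqj; ring.
by apply/rowP => j; rewrite eqj H eqg; ring.
Qed.

End Words.

(** * The solution of the Burgers equation *)

Section Solution.
Context {R : realType} {d : nat} (nu : R) (d0 : (0 < d)%N) (nu0 : 0 < nu).
Local Notation E := 'rV[R]_d.
Local Notation jet := ('I_d -> seq 'I_d -> E -> R).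
Implicit Types (T C : R) (i j : 'I_d) (s : seq 'I_d) (x y : E) (t r : R).
Context (u0 : E -> E) (g : R -> E -> E).
Hypotheses (u0_smooth : smooth u0) (g_smooth : smooth_on_halfspace g).
Hypothesis u0_bounded : forall k : nat, (sup_norm (nabla k u0) < +oo)%E.

Let u0_jet : jet := fun j s x => partial_derive s u0 x 0 j.
Let g_jet : R -> jet := field_jet g.

Lemma initial_bounds : exists A : nat -> R, (forall k, 0 <= A k) /\
  forall j s x, `|u0_jet j s x| <= A (size s).
Proof.
have /choice [A HA] (k : nat) : exists C : R, 0 <= C /\
    forall j s x, size s = k -> `|u0_jet j s x| <= C.
  have [C HC] : exists C : R, forall (s : k.-tuple 'I_d) j x,
      `|nabla k u0 x s 0 j| <= C.
    have : exists C : R, (sup_norm (nabla k u0) < C%:E)%E.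
      case: (sup_norm (nabla k u0)) (u0_bounded k) => [r| |] // _.
        by exists (r + 1); rewrite lte_fin ltrDl.
      by exists 0; exact: ltNyr.
    by move=> [C HC]; exists C => s j x; exact: sup_norm_component.
  exists `|C|; split => // j s x /eqP sk.
  by have := HC (Tuple sk) j x; rewrite ffunE => /le_trans; apply; exact: ler_norm.
by exists A; split => [k|j s x]; [exact: (HA k).1|exact: (HA _).2].
Qed.

Lemma data_admissible T (A B : nat -> R) : 0 <= T ->
  (forall j s x, `|u0_jet j s x| <= A (size s)) ->
  (forall t j s x, 0 <= t -> t <= T -> `|g_jet t j s x| <= B (size s)) ->
  admissible (A 0%N + T * B 0%N) A B T u0_jet g_jet.
Proof.
move=> T0 HA HB; split => //.
- by move=> j; exact: smooth_jet.
- by move=> t j t0; exact: field_jet_jet.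
Qed.

Definition solution t x : E := \row_j limit_solution nu u0_jet g_jet t j [::] x.

Hypothesis g_bounded : bounded_derivatives g.

Lemma data_admissible_ex T : 0 <= T -> exists (M : R) (A B : nat -> R),
  [/\ forall k, 0 <= A k, forall k, 0 <= B k & admissible M A B T u0_jet g_jet].
Proof.
move=> T0; have [A [A0 HA]] := initial_bounds.
have /choice [B HB] (k : nat) := word_bound 0 k g_bounded T0.
exists (A 0%N + T * B 0%N), A, B; split => // [k|]; first exact: (HB k).1.
by apply: data_admissible => // t j s x t0 tT; exact: (HB (size s)).2.
Qed.

Lemma g_jet_lip T (k : nat) : 0 <= T -> exists L : R, 0 <= L /\
  forall t t' j s x, 0 <= t -> t <= t' -> t' <= T -> (size s <= k)%N ->
    `|g_jet t' j s x - g_jet t j s x| <= L * (t' - t).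
Proof.
move=> T0; have [L [L0 HL]] := word_bound 1 k g_bounded T0.
exists L; split => // t t' j s x t0 tt' t'T sk.
apply: word_derive_lip => // r /andP[tr rt'].
by apply: (HL r s j x) => //; [exact: le_trans tr|exact: le_trans t'T].
Qed.

Local Notation V := (limit_solution nu u0_jet g_jet).

Let V_jet t j : 0 <= t -> is_jet (V t j).
Proof. by move=> t0; exact: (limit_solution_jet d0 nu0 data_admissible_ex j t0). Qed.

Let V_time t j s x : 0 <= t ->
  time_quotient (fun r => V r j s x) t --> generator nu (V t) (g_jet t) j s x.
Proof.
move=> t0.
exact: (limit_solution_time_quotient d0 nu0 data_admissible_ex g_jet_lip t0).
Qed.

Let family := @poly_family R d V (word_derive g).

(** Smoothness ranges over every order of differentiation, so the family admits all words in the
    forcing. *)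
Lemma solution_smooth : smooth_on_halfspace solution.
Proof.
apply: (@smooth_of_stable_family _ _ (family (fun=> True))) => [f Pf|j].
  split; last first.
    move=> a; apply: (poly_derivative (nu := nu)) Pf => //.
    by move=> b w j t x t0 _; exact: word_derive_deriv.
  apply: poly_continuous Pf => [j s|w j _].
    exact: (limit_solution_continuous d0 nu0 data_admissible_ex g_jet_lip).
  exact: word_derive_continuous.
rewrite (_ : (fun t x => _) = fun t x => V t j [::] x); first exact: poly_sol.
by apply/funext => t; apply/funext => x; rewrite mxE.
Qed.

Lemma solution_jet t : 0 <= t -> field_jet solution t = V t.
Proof.
move=> t0; apply/funext => j; apply/funext => s; apply/funext => x.
elim: s t t0 x j => [|i s ih] t t0 x j; first by rewrite /field_jet/word_derive/= mxE.
have H : coord_derive (Some i) (foldr coord_derive solution (map some s)) t x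
    = \row_k V t k (i :: s) x.
  apply: (coord_derive_row t0 _).2 => k; rewrite mxE.
  apply: (coord_deriv_to_ext (f := fun r y => V r k s y)) => //.
    by move=> r y r0; rewrite -ih.
  exact: V_jet.
by have := congr1 (fun M : E => M 0 j) H; rewrite [X in _ = X]mxE.
Qed.

Lemma solution_burgers : burgers_solution nu u0 g solution.
Proof.
split; first exact: solution_smooth.
- move=> t x t0; apply/burgers_component => j; rewrite solution_jet//.
  have H : coord_derive None solution t x
      = \row_k generator nu (V t) (g_jet t) k [::] x.
    apply: (coord_derive_row t0 _).2 => k; rewrite mxE.
    apply: (coord_deriv_to_ext (f := fun r y => V r k [::] y)) => //.
      by move=> r y r0; rewrite mxE.
    exact: V_time.
  by have := congr1 (fun M : E => M 0 j) H; rewrite [X in _ = X]mxE.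
- move=> x; apply/rowP => j; rewrite mxE.
  exact: limit_solution0.
Qed.

(* Time derivatives are outermost in these words, as in [dt_nabla]. *)
Definition time_first (w : seq (option 'I_d)) : Prop :=
  exists mu s, w = nseq mu None ++ map some s.

(** The bounds on [g] concern words with time derivatives outermost. Spatial derivatives of the
    solution are taken first, and [time_first] is stable under further time derivatives, so only
    words with known bounds occur. *)
Lemma solution_word (mu : nat) s j : exists f, family time_first f /\
  forall t x, 0 <= t -> word_derive solution (nseq mu None ++ map some s) j t x = f t x.
Proof.
elim: mu j => [|mu ih] j.
  exists (fun t x => V t j s x); split; first exact: poly_sol.
  by move=> t x t0; rewrite -solution_jet.
have tf : forall w, time_first w -> time_first (None :: w).
  by move=> w [m [s' ->]]; exists m.+1, s'.
have H k : exists f', family time_first f' /\ forall t x, 0 <= t ->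
    coord_deriv_to None (word_derive solution (nseq mu None ++ map some s) k) t x (f' t x).
  have [f [Pf ef]] := ih k.
  have [||f' [Pf' df]] := poly_derivative (nu := nu) V_jet V_time _ _ tf Pf.
  - by move=> a w i t x t0 _; exact: word_derive_deriv.
  - by move=> s'; exists 0%N, s'.
  exists f'; split => // t x t0; apply: coord_deriv_to_ext t0 _ (df t x t0).
  by move=> r y r0; rewrite ef.
have /choice [F HF] := H; exists (F j); split; first exact: (HF j).1.
move=> t x t0.
have E1 : coord_derive None (foldr coord_derive solution (nseq mu None ++ map some s)) t x
    = \row_k F k t x.
  by apply: (coord_derive_row t0 _).2 => k; rewrite mxE; exact: (HF k).2.
by have := congr1 (fun M : E => M 0 j) E1; rewrite [X in _ = X]mxE.
Qed.

Lemma solution_bounded_on (I : R -> Prop) (mu k : nat) :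
  (forall t, I t -> 0 <= t) ->
  (forall j s, exists C : R, forall t x, I t -> `|V t j s x| <= C) ->
  (forall w j, time_first w ->
     exists C : R, forall t x, I t -> `|word_derive g w j t x| <= C) ->
  exists C : R, forall t, I t -> (sup_norm (dt_nabla mu k solution t) < C%:E)%E.
Proof.
move=> I0 bV bG; apply: sup_norm_lt => s j.
have [f [Pf ef]] := solution_word mu s j.
have [C HC] := poly_bounded bV bG Pf; exists C => t x It.
by rewrite dt_nabla_word -[X in `|X|]/(word_derive _ _ _ _ _) ef ?HC// I0.
Qed.

Lemma solution_bounded : bounded_derivatives solution.
Proof.
move=> mu k T T0.
have [|||C HC] := @solution_bounded_on (fun t => 0 <= t /\ t <= T) mu k.
- by move=> t [].
- move=> j s; have [C [_ HC]] :=
    limit_solution_le d0 nu0 data_admissible_ex (size s) (ltW T0).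
  by exists C => t x [t0 tT]; exact: HC.
- move=> w j [m [s ->]]; have [C [_ HC]] := word_bound m (size s) g_bounded (ltW T0).
  by exists C => t x [t0 tT]; exact: HC.
by exists C => t t0 tT; exact: HC.
Qed.

(** Spatial bounds up to order three give consistency of the scheme on [v]; bounds on its first and
    second time derivatives give the Lipschitz estimate and the time expansion. *)
Lemma solution_unique v : burgers_solution nu u0 g v -> bounded_derivatives v ->
  forall t x, 0 <= t -> v t x = solution t x.
Proof.
move=> [v_smooth v_eq v_init] v_bounded t x t0; apply/rowP => j; rewrite mxE.
have t10 : 0 <= t + 1 by lra.
have v_gen r k y : 0 <= r -> word_derive v [:: None] k r y
    = generator nu (field_jet v r) (g_jet r) k [::] y.
  by move=> r0; apply: (burgers_component nu v g r y).1; exact: v_eq.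
have [C [_ HC]] := word_bound 0 3 v_bounded t10.
have [K [K0 HK]] := word_bound 2 0 v_bounded t10.
have [L [L0 HL]] := word_bound 1 0 v_bounded t10.
apply: (limit_solution_unique (v := field_jet v) (T := t + 1) (C := C) (K := K + L)
  d0 nu0 data_admissible_ex) => //; last by lra.
- by move=> r k r0; exact: field_jet_jet.
- by move=> r k s y r0 rT sk; exact: (HC r s k y).
- by move=> k y; rewrite /field_jet /word_derive /= v_init.
- move=> a b k y a0 ab bT; rewrite -v_gen//.
  apply: (@le_trans _ _ (K * (b - a) ^+ 2)); last first.
    by rewrite ler_wpM2r ?sqr_ge0//; lra.
  apply: word_derive_expansion => // r /andP[ar rb].
  by apply: (HK r [::] k y) => //; [exact: le_trans ar|exact: le_trans bT].
- move=> a b k y a0 ab bT; apply: (@le_trans _ _ (L * (b - a))); last first.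
    by rewrite ler_wpM2r//; lra.
  apply: word_derive_lip => // r /andP[ar rb].
  by apply: (HL r [::] k y) => //; [exact: le_trans ar|exact: le_trans bT].
Qed.

(** With zero forcing the bound [M] is [A 0] whatever the horizon, so one constant of
    [limit_solution_uniform] serves all times; it is used with horizon [t] itself. *)
Lemma solution_uniform_bound : (forall t x, 0 <= t -> g t x = 0) ->
  forall mu k : nat, exists C : R, forall t, 0 <= t ->
    (sup_norm (dt_nabla mu k solution t) < C%:E)%E.
Proof.
move=> g0 mu k.
have wg0 w t x : 0 <= t -> foldr coord_derive g w t x = 0.
  elim: w t x => [|a w ih] t x t0; first exact: g0.
  apply: (coord_derive_row (F := foldr coord_derive g w) t0 _).2 => j; rewrite mxE.
  apply: (coord_deriv_to_ext (f := fun _ _ => 0)) => //.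
    by move=> r y r0; rewrite ih// mxE.
  by case: a => [i|] /=; [exact: is_derive_cst_fun|exact: time_quotient_cst].
have [A [A0 HA]] := initial_bounds.
apply: solution_bounded_on => // [j s|w j _]; last first.
  by exists 0 => t x t0; rewrite /word_derive wg0// mxE normr0.
have B0 (l : nat) : 0 <= (0 : R) by [].
have [C [_ HC]] := limit_solution_uniform d0 nu0 data_admissible_ex (size s) (A0 0%N) A0 B0.
exists C => t x t0; apply: (HC t) => //.
rewrite -[A 0%N]addr0 -[X in A 0%N + X](mulr0 t).
apply: (data_admissible (B := fun=> 0)) => // r i w y r0 rt.
by rewrite /g_jet /field_jet /word_derive wg0// mxE normr0.
Qed.

End Solution.

Unset Implicit Arguments.

Theorem corollary1p2 (R : realType) (d : nat) (hd : (1 <= d)%N)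
    (nu : R) (hnu : 0 < nu)
    (u0 : 'rV[R]_d -> 'rV[R]_d) (g : R -> 'rV[R]_d -> 'rV[R]_d)
    (u0_smooth : smooth u0) (g_smooth : smooth_on_halfspace g)
    (u0_bounded : forall k : nat, (sup_norm (nabla k u0) < +oo)%E)
    (g_bounded : bounded_derivatives g) :
  exists u : R -> 'rV[R]_d -> 'rV[R]_d,
    [/\ burgers_solution nu u0 g u,
        bounded_derivatives u,
        (forall v : R -> 'rV[R]_d -> 'rV[R]_d,
           burgers_solution nu u0 g v -> bounded_derivatives v ->
           forall (t : R) (x : 'rV[R]_d), 0 <= t -> v t x = u t x)
      & ((forall (t : R) (x : 'rV[R]_d), 0 <= t -> g t x = 0) ->
         forall mu k : nat, exists C : R, forall t : R, 0 <= t ->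
           (sup_norm (dt_nabla mu k u t) < C%:E)%E)].
Proof.
exists (solution nu u0 g); split.
- exact: solution_burgers.
- exact: solution_bounded.
- exact: solution_unique.
- exact: solution_uniform_bound.
Qed.
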